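(* Let $n\ge 3$ and let $\mathfrak{g}$ be the Lie superalgebra of complex $2n\times 2n$ matrices $\begin{pmatrix} a&b\\ b&a\end{pmatrix}$ with $a,b\in\mathfrak{gl}(n)$ (even part: $b=0$; odd part: $a=0$), and let $\mathfrak{g}'$ be its derived algebra, consisting of the matrices of this form with $b\in\mathfrak{sl}(n)$; thus $\mathfrak{g}'_0=\mathfrak{g}_0\cong\mathfrak{gl}(n)$. Let $\mu$ be a partition of $n$, let $\mathcal{O}_\mu\subset\mathfrak{g}_0$ be the nilpotent orbit of matrices of Jordan type $\mu$, and let $q$ be the prime ideal of $S(\mathfrak{g}_0)$ whose zero set $V(q)$ is $\overline{\mathcal{O}}_\mu$. Let $k(q)$ and $k'(q)$ be the ranks of the bilinear forms over $F_q=\mathrm{Fract}(S(\mathfrak{g}_0)/q)$ on $\mathfrak{g}_1\otimes F_q$ and $\mathfrak{g}'_1\otimes F_q$, respectively, induced by the Lie bracket. Then: (a) $k(q)=\dim\mathfrak{g}_1-\sum_i(\mu_i')^2$; (b) $k'(q)=k(q)-2\epsilon(\mu)$, where $\epsilon(\mu)=1$ if all parts of $\mu$ are even and $\epsilon(\mu)=0$ otherwise.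
   Context: The bracket of two odd elements $x,y$ is $[x,y]=xy+yx$. The dual partition is $\mu'_i=|\{j:\mu_j\ge i\}|$. $\mathfrak{g}_0\cong\mathfrak{gl}(n)$ is identified with $\mathfrak{g}_0^*$ via a nondegenerate invariant form (e.g. the trace form of $\mathfrak{gl}(n)$), so elements of $S(\mathfrak{g}_0)$ are functions on $\mathfrak{g}_0$. The bracket $\mathfrak{g}_1\times\mathfrak{g}_1\to\mathfrak{g}_0\subset S(\mathfrak{g}_0)$, reduced modulo $q$, extends to a symmetric $F_q$-bilinear form on $\mathfrak{g}_1\otimes F_q$; similarly for $\mathfrak{g}_1'$. *)

(* Defs.v *)
From HB Require Import structures.
From mathcomp Require Import all_boot all_order all_algebra ring.
From mathcomp Require Import sesquilinear ring_quotient generic_quotient fraction.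
From mathcomp Require Import boolp reals.
From mathcomp Require Import complex.
From mathcomp Require Import mpoly.

Set Implicit Arguments.
Unset Strict Implicit.
Unset Printing Implicit Defensive.

Import GRing.Theory.
Local Open Scope ring_scope.
Local Open Scope quotient_scope.

(* MathComp makes R/I a commutative ring but gives it no inverses, so that the
   field of fractions of R/I cannot be formed; inverses are chosen here. *)
Section PrimeQuotient.
Variables (R : comNzRingType) (I : prime_idealr R).
Local Notation Q := {ideal_quot I}.

Definition quot_unit : pred Q := fun x => `[< exists y, y * x = 1 >].
Definition quot_inv (x : Q) : Q :=
  if pselect (exists y, y * x = 1) is left h then projT1 (cid h) else x.

Lemma quot_mulVx : {in quot_unit, left_inverse 1 quot_inv *%R}.
Proof.
move=> x /asboolP h; rewrite /quot_inv; case: pselect => // h'.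
by case: cid.
Qed.
Lemma quot_unitPl (x y : Q) : y * x = 1 -> quot_unit x.
Proof. by move=> h; apply/asboolP; exists y. Qed.
Lemma quot_inv_out : {in [predC quot_unit], quot_inv =1 id}.
Proof.
move=> x /negP h; rewrite /quot_inv; case: pselect => // h'.
by case: h; apply/asboolP.
Qed.

HB.instance Definition _ := GRing.ComNzRing_hasMulInverse.Build Q
  quot_mulVx quot_unitPl quot_inv_out.
HB.instance Definition _ := GRing.ComUnitRing_isIntegral.Build Q
  (@Quotient.rquot_IdomainAxiom R I).

End PrimeQuotient.

Section QueerAlgebra.
Variables (F : fieldType) (n : nat).
Local Notation gl2n := 'M[F]_(n + n).

Definition qmx (u : 'M[F]_n * 'M[F]_n) : gl2n := block_mx u.1 u.2 u.2 u.1.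

Lemma qmx_is_linear : linear qmx.
Proof.
by move=> c [a b] [a' b']; rewrite /qmx /= scale_block_mx add_block_mx.
Qed.
HB.instance Definition _ := GRing.isLinear.Build F _ gl2n _ qmx qmx_is_linear.

Definition qalg : {vspace gl2n} := limg (linfun qmx).

Definition evenpart (x : gl2n) : gl2n := block_mx (ulsubmx x) 0 0 (drsubmx x).
Definition oddpart (x : gl2n) : gl2n := block_mx 0 (ursubmx x) (dlsubmx x) 0.

Lemma evenpart_is_linear : linear evenpart.
Proof.
move=> c x y; rewrite /evenpart scale_block_mx add_block_mx.
by congr block_mx; apply/matrixP => i j; rewrite !mxE ?mulr0 ?addr0.
Qed.
HB.instance Definition _ :=
  GRing.isLinear.Build F gl2n gl2n _ evenpart evenpart_is_linear.
Lemma oddpart_is_linear : linear oddpart.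
Proof.
move=> c x y; rewrite /oddpart scale_block_mx add_block_mx.
by congr block_mx; apply/matrixP => i j; rewrite !mxE ?mulr0 ?addr0.
Qed.
HB.instance Definition _ :=
  GRing.isLinear.Build F gl2n gl2n _ oddpart oddpart_is_linear.

Definition evensub (U : {vspace gl2n}) : {vspace gl2n} :=
  (U :&: lker (linfun oddpart))%VS.
Definition oddsub (U : {vspace gl2n}) : {vspace gl2n} :=
  (U :&: lker (linfun evenpart))%VS.

(* The bilinear extension of [x, y] = xy - (-1)^(|x||y|) yx; see sbracket_odd. *)
Definition sbracket (x y : gl2n) : gl2n :=
  x *m y - y *m x + (oddpart y *m oddpart x) *+ 2.

Definition derived (U : {vspace gl2n}) : {vspace gl2n} :=
  <<[seq sbracket x y | x <- vbasis U, y <- vbasis U]>>%VS.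

Lemma qalgP x : reflect (exists a b, x = block_mx a b b a) (x \in qalg).
Proof.
apply: (iffP memv_imgP) => [[[a b] _ ->]|[a [b ->]]].
  by exists a, b; rewrite lfunE.
by exists (a, b); rewrite ?memvf // lfunE.
Qed.

Lemma evensubP x :
  reflect (exists a, x = block_mx a 0 0 a) (x \in evensub qalg).
Proof.
rewrite memv_cap; apply: (iffP andP) => [[/qalgP[a [b ->]]]|[a ->]].
  rewrite memv_ker lfunE /= /oddpart block_mxKur block_mxKdl => /eqP.
  by rewrite -[RHS](@block_mx0 _ n n n n) => /eq_block_mx[_ -> _ _]; exists a.
split; first by apply/qalgP; exists a, 0.
by rewrite memv_ker lfunE /= /oddpart block_mxKur block_mxKdl block_mx0.
Qed.

Lemma oddsubP x :
  reflect (exists b, x = block_mx 0 b b 0) (x \in oddsub qalg).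
Proof.
rewrite memv_cap; apply: (iffP andP) => [[/qalgP[a [b ->]]]|[b ->]].
  rewrite memv_ker lfunE /= /evenpart block_mxKul block_mxKdr => /eqP.
  by rewrite -[RHS](@block_mx0 _ n n n n) => /eq_block_mx[-> _ _ _]; exists b.
split; first by apply/qalgP; exists 0, b.
by rewrite memv_ker lfunE /= /evenpart block_mxKul block_mxKdr block_mx0.
Qed.

Lemma sbracket_odd x y : evenpart x = 0 -> evenpart y = 0 ->
  sbracket x y = x *m y + y *m x.
Proof.
have odd_id z : evenpart z = 0 -> oddpart z = z.
  move=> z0; rewrite -[RHS]submxK /oddpart.
  move: z0; rewrite /evenpart -[RHS](@block_mx0 _ n n n n).
  by case/eq_block_mx=> -> _ _ ->.
by move=> /odd_id hx /odd_id hy; rewrite /sbracket hx hy mulr2n -addrA addKr.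
Qed.

Lemma sbracket_linearl (y : gl2n) : linear (sbracket^~ y).
Proof.
move=> c x x'; rewrite /sbracket [oddpart (_ + _)]linearP.
rewrite !mulmxDl !mulmxDr -!scalemxAl -!scalemxAr.
move: (x *m y) (x' *m y) (y *m x) (y *m x') => A B D E.
move: (oddpart y *m oddpart x) (oddpart y *m oddpart x') => G H.
by apply/matrixP => i j; rewrite !mxE; ring.
Qed.

Lemma sbracket_linearr (x : gl2n) : linear (sbracket x).
Proof.
move=> c y y'; rewrite /sbracket [oddpart (_ + _)]linearP.
rewrite !mulmxDl !mulmxDr -!scalemxAl -!scalemxAr.
move: (x *m y) (x *m y') (y *m x) (y' *m x) => A B D E.
move: (oddpart y *m oddpart x) (oddpart y' *m oddpart x) => G H.
by apply/matrixP => i j; rewrite !mxE; ring.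
Qed.

HB.instance Definition _ x := GRing.isLinear.Build F gl2n gl2n _
  (sbracket x) (sbracket_linearr x).

Lemma mem_derived (U : {vspace gl2n}) x y :
  x \in U -> y \in U -> sbracket x y \in derived U.
Proof.
move=> xU yU; rewrite (coord_vbasis xU) (coord_vbasis yU).
rewrite linear_sum /=; apply: memv_suml => j _.
rewrite linearZ /= memvZ //.
pose sbl z : gl2n -> gl2n := sbracket^~ z.
pose sblL z : {linear gl2n -> gl2n} :=
  HB.pack (sbl z) (GRing.isLinear.Build F _ _ _ (sbl z) (sbracket_linearl z)).
rewrite -[sbracket _ _]/(sblL _ _) linear_sum; apply: memv_suml => i _.
rewrite linearZ memvZ //= /sbl.
by apply: memv_span; apply: allpairs_f; rewrite mem_nth // size_tuple.
Qed.

Lemma sbracket_qmx (a b c d : 'M[F]_n) :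
  sbracket (qmx (a, b)) (qmx (c, d)) =
  qmx (a *m c - c *m a + (b *m d + d *m b), a *m d - d *m a + (b *m c - c *m b)).
Proof.
rewrite /sbracket /qmx /= /oddpart !block_mxKur !block_mxKdl !mulmx_block.
rewrite opp_block_mx mulr2n !add_block_mx !(mulmx0, mul0mx) !addr0 !add0r.
move: (a *m c) (c *m a) (b *m d) (d *m b) (a *m d) (d *m a) (b *m c) (c *m b).
by move=> *; congr block_mx; apply/matrixP => i j; rewrite !mxE; ring.
Qed.

Lemma derived_qalgP x : (0 < n)%N -> 2%:R != 0 :> F ->
  reflect (exists a b, \tr b = 0 /\ x = block_mx a b b a) (x \in derived qalg).
Proof.
move=> n_gt0 char2; apply: (iffP idP) => [|[a [b [trb ->]]]].
  pose tr_ur (u : 'M[F]_n * 'M[F]_n) : F^o := \tr u.2.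
  have tr_lin : linear tr_ur by move=> c [u v] [u' v']; rewrite /tr_ur /= linearP.
  pose trL := GRing.isLinear.Build F _ _ _ tr_ur tr_lin.
  pose tr_urL : {linear _ -> _} := HB.pack tr_ur trL.
  suff /subvP s : (derived qalg <= linfun qmx @: lker (linfun tr_urL))%VS.
    move=> /s /memv_imgP[[a b] + ->]; rewrite memv_ker (lfunE tr_urL) lfunE /= => /eqP h.
    by exists a, b.
  apply/span_subvP => _ /allpairsP[[y z] /= [/vbasis_mem yQ /vbasis_mem zQ ->]].
  case/qalgP: yQ => a [b ->]; case/qalgP: zQ => c [d ->].
  rewrite -[block_mx a b b a]/(qmx (a, b)) -[block_mx c d d c]/(qmx (c, d)).
  rewrite sbracket_qmx -(lfunE qmx); apply: memv_img.
  rewrite memv_ker (lfunE tr_urL) /= /tr_ur /= !raddfD /= !raddfN /=.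
  by rewrite (mxtrace_mulC a) (mxtrace_mulC b) !subrr addr0.
pose i0 := Ordinal n_gt0.
have qmxQ u : qmx u \in qalg by apply/qalgP; exists u.1, u.2.
have -> : block_mx a b b a = qmx (a, 0) + qmx (0, b).
  by rewrite -linearD /= /qmx /= !addr0 !add0r.
apply: memvD.
  have -> : qmx (a, 0) = sbracket (qmx (0, 2^-1 *: a)) (qmx (0, 1%:M)).
    rewrite sbracket_qmx !(mulmx0, mul0mx, mulmx1, mul1mx) !subrr !add0r.
    by rewrite -scalerDl -[2^-1]mul1r -mulrDl divff // scale1r.
  exact: mem_derived.
have -> : b = \sum_i \sum_j b i j *:
    (delta_mx i i0 *m delta_mx i0 j - delta_mx i0 j *m delta_mx i i0).
  under eq_bigr => i _ do under eq_bigr => j _ do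
    rewrite mul_delta_mx mul_delta_mx_cond scalerBr.
  under eq_bigr => i _ do rewrite sumrB.
  rewrite sumrB -matrix_sum_delta.
  suff -> : \sum_i \sum_j b i j *: (delta_mx i0 i0 *+ (j == i)) = \tr b *: delta_mx i0 i0.
    by rewrite trb scale0r subr0.
  rewrite /mxtrace scaler_suml; apply: eq_bigr => i _.
  rewrite (bigD1 i) //= eqxx mulr1n big1 ?addr0 // => j /negbTE ->.
  by rewrite mulr0n scaler0.
pose q0 (v : 'M[F]_n) := qmx (0, v).
have q0_lin : linear q0.
  by move=> c u v; rewrite /q0 -linearP /=; congr qmx; congr pair; rewrite /= scaler0 addr0.
pose q0L : {linear _ -> _} := HB.pack q0 (GRing.isLinear.Build F _ _ _ q0 q0_lin).
rewrite -/(q0 _) -[q0]/(q0L : _ -> _).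
rewrite linear_sum; apply: memv_suml => i _.
rewrite linear_sum; apply: memv_suml => j _.
rewrite linearZ memvZ //= /q0.
have -> : qmx (0, delta_mx i i0 *m delta_mx i0 j - delta_mx i0 j *m delta_mx i i0)
   = sbracket (qmx (delta_mx i i0, 0)) (qmx (0, delta_mx i0 j)).
  by rewrite sbracket_qmx !(mulmx0, mul0mx) !subrr !addr0.
exact: mem_derived.
Qed.

End QueerAlgebra.

(* Listed as its nonzero parts in weakly decreasing order. *)
Definition is_partition (n : nat) (mu : seq nat) : bool :=
  [&& sorted geq mu, 0%N \notin mu & sumn mu == n].

Definition dual_part (mu : seq nat) (i : nat) : nat :=
  count (fun m => (i <= m)%N) mu.

Definition eps_even (mu : seq nat) : nat := all (fun m => ~~ odd m) mu.

Section CoadjointGeometry.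
Variables (F : fieldType) (n : nat).

(* Rows and columns are cut into consecutive intervals of lengths mu_1, mu_2,
   and so on; reshape_index mu i is the interval containing i. *)
Definition jordan_mx (mu : seq nat) : 'M[F]_n :=
  \matrix_(i, j) ((j == i.+1 :> nat) &&
                  (reshape_index mu i == reshape_index mu j))%:R.

Definition nilp_orbit (mu : seq nat) (x : 'M[F]_n) : Prop :=
  exists2 g, g \in unitmx & x = g *m jordan_mx mu *m invmx g.

(* Here a polynomial is evaluated at the matrix entries. *)
Definition zariski_closure (A : 'M[F]_n -> Prop) (y : 'M[F]_n) : Prop :=
  forall p : {mpoly F[n * n]},
    (forall x, A x -> p.@[fun k => mxvec x 0 k] = 0) ->
    p.@[fun k => mxvec y 0 k] = 0.

(* S(gl(n)): the variable of index mxvec_index i j stands for the elementary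
   matrix E_ij, and sym_lin is the embedding of gl(n). *)
Local Notation S := {mpoly F[n * n]}.

Definition sym_lin (a : 'M[F]_n) : S := \sum_k mxvec a 0 k *: 'X_k.

Definition invariant_form (kappa : 'M[F]_n -> 'M[F]_n -> F) : Prop :=
  forall x y z,
    kappa (x *m y - y *m x) z = kappa x (y *m z - z *m y).

Variable kappa : {symmetric 'M[F]_n}.

(* The function on gl(n) defined by an element of S(gl(n)), gl(n) being
   identified with its dual through kappa; see sym_eval_lin. *)
Definition sym_eval (p : S) (y : 'M[F]_n) : F :=
  p.@[fun k => kappa (vec_mx (delta_mx 0 k)) y].

Lemma sym_eval_lin a y : sym_eval (sym_lin a) y = kappa a y.
Proof.
rewrite /sym_eval /sym_lin raddf_sum /= -[in RHS](mxvecK a).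
rewrite {2}[mxvec a]row_sum_delta linear_sum.
rewrite linear_sumlz; apply: eq_bigr => k _.
by rewrite mevalZ mevalXU linearZ linearZl_LR.
Qed.

Definition zero_set (q : {pred S}) (y : 'M[F]_n) : Prop :=
  forall p, p \in q -> sym_eval p y = 0.

End CoadjointGeometry.

Section BracketForm.
Variables (F : fieldType) (n : nat) (q : prime_idealr {mpoly F[n * n]}).

Definition residue_field : fieldType := {fraction {ideal_quot q}}.

Definition to_residue (p : {mpoly F[n * n]}) : residue_field :=
  FracField.tofrac (\pi_{ideal_quot q} p).

(* Meant for odd x and y; ulsubmx maps the even part isomorphically onto gl(n). *)
Definition bracket_form (x y : 'M[F]_(n + n)) : residue_field :=
  to_residue (sym_lin (ulsubmx (sbracket x y))).

Definition bracket_gram d (X : d.-tuple 'M[F]_(n + n)) : 'M[residue_field]_d :=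
  \matrix_(i, j) bracket_form (tnth X i) (tnth X j).

(* The rank of the form on U (x) F_q; see bracket_rank_basis. *)
Definition bracket_rank (U : {vspace 'M[F]_(n + n)}) : nat :=
  \rank (bracket_gram (vbasis U)).

Lemma to_residueD : {morph to_residue : x y / x + y}.
Proof. by move=> x y; rewrite /to_residue !rmorphD. Qed.
Lemma to_residueM : {morph to_residue : x y / x * y}.
Proof. by move=> x y; rewrite /to_residue !rmorphM. Qed.

Lemma to_residue0 : to_residue 0 = 0.
Proof. by rewrite /to_residue !rmorph0. Qed.

Lemma sym_lin_is_linear : linear (@sym_lin F n).
Proof.
move=> c a b; rewrite /sym_lin scaler_sumr -big_split /=.
by apply: eq_bigr => k _; rewrite linearP !mxE scalerDl scalerA.
Qed.

Lemma bracket_form_suml e (c : 'I_e -> F) (Y : 'I_e -> 'M[F]_(n + n)) x :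
  bracket_form (\sum_k c k *: Y k) x =
  \sum_k to_residue (c k)%:MP * bracket_form (Y k) x.
Proof.
pose f y := sym_lin (ulsubmx (sbracket y x)).
have f_lin : linear f.
  move=> a u v; rewrite /f sbracket_linearl -sym_lin_is_linear; congr sym_lin.
  by apply/matrixP => i j; rewrite !mxE.
pose fL : {linear _ -> _} := HB.pack f (GRing.isLinear.Build F _ _ _ f f_lin).
rewrite /bracket_form -/(f _) -[f _]/(fL _) linear_sum.
rewrite (big_morph _ to_residueD to_residue0).
by apply: eq_bigr => k _; rewrite linearZ /= -mul_mpolyC to_residueM.
Qed.

Lemma bracket_form_sumr e (c : 'I_e -> F) (Y : 'I_e -> 'M[F]_(n + n)) x :
  bracket_form x (\sum_k c k *: Y k) =
  \sum_k to_residue (c k)%:MP * bracket_form x (Y k).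
Proof.
pose f y := sym_lin (ulsubmx (sbracket x y)).
have f_lin : linear f.
  move=> a u v; rewrite /f sbracket_linearr -sym_lin_is_linear; congr sym_lin.
  by apply/matrixP => i j; rewrite !mxE.
pose fL : {linear _ -> _} := HB.pack f (GRing.isLinear.Build F _ _ _ f f_lin).
rewrite /bracket_form -/(f _) -[f _]/(fL _) linear_sum.
rewrite (big_morph _ to_residueD to_residue0).
by apply: eq_bigr => k _; rewrite linearZ /= -mul_mpolyC to_residueM.
Qed.

Lemma bracket_rank_le d (X : d.-tuple 'M[F]_(n + n))
    e (Y : e.-tuple 'M[F]_(n + n)) :
  {subset X <= <<Y>>%VS} -> (\rank (bracket_gram X) <= \rank (bracket_gram Y))%N.
Proof.
move=> XY; pose P : 'M_(d, e) :=
  \matrix_(i, k) to_residue (coord Y k (tnth X i))%:MP.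
suff -> : bracket_gram X = P *m bracket_gram Y *m P^T.
  exact: leq_trans (mxrankM_maxl _ _) (mxrankM_maxr _ _).
have coordX i : tnth X i = \sum_k coord Y k (tnth X i) *: Y`_k.
  exact/coord_span/XY/mem_tnth.
apply/matrixP => i j; rewrite !mxE {1}(coordX j) bracket_form_sumr.
apply: eq_bigr => k _; rewrite !mxE mulrC; congr (_ * _).
rewrite {1}(coordX i) bracket_form_suml.
by apply: eq_bigr => l _; rewrite !mxE !(tnth_nth 0).
Qed.

Lemma bracket_rank_basis (U : {vspace 'M[F]_(n + n)})
    (X : (\dim U).-tuple 'M[F]_(n + n)) :
  basis_of U X -> \rank (bracket_gram X) = bracket_rank U.
Proof.
move=> XU; apply/eqP; rewrite eqn_leq /bracket_rank.
rewrite !bracket_rank_le // => x.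
  by move/vbasis_mem; rewrite (span_basis XU).
by move/(basis_mem XU); rewrite (span_basis (vbasisP U)).
Qed.

End BracketForm.

(* Main.v *)
Require Import Defs.
From HB Require Import structures.
From mathcomp Require Import all_boot all_order all_algebra.
From mathcomp Require Import sesquilinear ring_quotient generic_quotient fraction.
From mathcomp Require Import boolp reals complex mpoly.

Set Implicit Arguments.
Unset Strict Implicit.
Unset Printing Implicit Defensive.

Import GRing.Theory.
Local Open Scope ring_scope.

(** A minor of the matrix of the bracket lies outside q exactly when it is
    nonzero somewhere on the orbit (this needs the Nullstellensatz, since q is
    only known through its zero set), so the rank over F_q is the rank at any
    point y of the orbit, where it is constant. An invariant form agrees up to a
    nonzero scalar with the trace form when one argument is traceless, so at y
    the bracket form is tr(c T(x)) with T(x) = yx + xy.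

    For y a Jordan matrix the kernel of T is computed block by block: on a block
    of size a x b it consists of signed Toeplitz matrices depending on min(a, b)
    parameters, and the sum of min(mu_p, mu_q) over p, q equals the sum of the
    mu'_i ^ 2. On sl(n) the radical is the set of traceless x with T(x) scalar. If
    all parts are even, an explicit traceless x has T(x) = 1 and, T being
    self-adjoint for the trace form, the kernel of T is traceless: the radical
    gains one dimension while the space loses one. If some part is odd, the kernel
    contains a matrix of nonzero trace, so 1 is not in the image of T: both the
    radical and the space lose one dimension. *)

(** * Nullstellensatz by elimination of variables *)

Section Elimination.
Variables (B : idomainType) (L : fieldType) (e : {rmorphism B -> L}) (x : L).

Local Notation ev g := (map_poly e g).[x].

Lemma truncate_poly (g : {poly B}) :
  exists2 h, map_poly e h = map_poly e g & size h = size (map_poly e g).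
Proof.
pose s := size (map_poly e g); pose h := take_poly s g.
have eh : map_poly e h = map_poly e g.
  apply/polyP => i; rewrite coef_map coef_take_poly.
  by case: ltnP => si; [rewrite coef_map | rewrite raddf0 nth_default].
exists h => //; apply/eqP; rewrite eqn_leq size_take_poly /=.
by rewrite -eh size_poly.
Qed.

Lemma lead_coef_truncated (g : {poly B}) :
  size g = size (map_poly e g) -> g != 0 -> e (lead_coef g) != 0.
Proof.
move=> sg g0; rewrite lead_coefE sg -coef_map -lead_coefE lead_coef_eq0.
by rewrite -size_poly_eq0 -sg size_poly_eq0.
Qed.

Variable f : {poly B}.
Hypotheses (f_size : size f = size (map_poly e f)) (f_neq0 : f != 0).
Hypothesis evf : ev f = 0.
Hypothesis f_min : forall g : {poly B},
  (size (map_poly e g) < size f)%N -> ev g = 0 -> map_poly e g = 0.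

(** Euclid's algorithm with pseudo-division: given [c *: f = h * g + r], an inverse of [r] at [x] up
    to a base element, multiplied by [- h], is one for [g]. *)
Lemma inverse_up_to_base_small (g : {poly B}) : (size g < size f)%N -> ev g != 0 ->
  exists v b, e b != 0 /\ ev v * ev g = e b.
Proof.
have [k] := ubnP (size g); elim: k g => // k IHk g0 sg0k sg0f evg0.
have [g eg sg] := truncate_poly g0; rewrite -eg in evg0 *.
have le_g : (size g <= size g0)%N by rewrite sg size_poly.
have sgf : (size g < size f)%N := leq_ltn_trans le_g sg0f.
have sgk := leq_trans le_g sg0k.
rewrite -eg in sg => {g0 sg0k sg0f eg le_g}.
have [g1|g1] := leqP (size g) 1.
  exists 1, g`_0; move: evg0; rewrite (size1_polyC g1) map_polyC hornerC coefC /=.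
  by move=> h; split=> //; rewrite rmorph1 hornerC mul1r.
have g_neq0 : g != 0 by rewrite -size_poly_gt0 ltnW.
have := Pdiv.WeakIdomain.divp_eq f g; set c := _ ^+ _; set h := _ %/ _; set r := _ %% _.
move=> fE; have ec : e c != 0.
  by rewrite rmorphXn expf_neq0 // lead_coef_truncated.
have sr : (size r < size g)%N by rewrite Pdiv.Idomain.ltn_modp.
have evE : 0 = ev h * ev g + ev r.
  by rewrite -hornerM -hornerD -rmorphM -rmorphD /= -fE map_polyZ hornerZ evf mulr0.
have c_neq0 : c != 0 by apply: contraNneq ec => ->; rewrite rmorph0.
have sh : (size h < size f)%N.
  have [->|h0] := eqVneq h 0; first by rewrite size_poly0 size_poly_gt0.
  have : (size (h * g)%R <= size f)%N.
    have -> : h * g = c *: f - r by rewrite fE addrK.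
    rewrite (leq_trans (size_polyD _ _)) // geq_max size_polyN size_scale //.
    by rewrite leqnn ltnW // (ltn_trans sr).
  rewrite size_mul //; apply: leq_trans; rewrite -(ltn_predK g1) addnS /=.
  by rewrite -addn1 leq_add2l -ltnS (ltn_predK g1).
(* If [h] vanished at [x], minimality would kill its image, and [c *: f] would have the same image
   as the shorter [r]. *)
have evh : ev h != 0.
  apply: contraTneq sr => evh0; have := f_min (leq_ltn_trans (size_poly _ _) sh) evh0.
  move=> h0; have : map_poly e (c *: f) = map_poly e r.
    by rewrite fE rmorphD rmorphM /= h0 mul0r add0r.
  rewrite map_polyZ => /(congr1 (size \o val)) /=; rewrite size_scale // -f_size => sf.
  by rewrite -leqNgt (leq_trans (ltnW sgf)) // sf size_poly.
have evr : ev r = - (ev h * ev g) by apply/eqP; rewrite -addr_eq0 addrC -evE.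
have evr0 : ev r != 0 by rewrite evr oppr_eq0 mulf_neq0.
have [||v [b [eb vb]]] := IHk r _ _ evr0.
- exact: leq_trans sr sgk.
- exact: ltn_trans sr sgf.
exists (- (v * h)), b; split=> //.
by rewrite rmorphN rmorphM /= hornerN hornerM -vb evr mulrN mulNr mulrA.
Qed.

Lemma inverse_up_to_base (g : {poly B}) : ev g != 0 ->
  exists v b, e b != 0 /\ ev v * ev g = e b.
Proof.
move=> evg; have := Pdiv.WeakIdomain.divp_eq g f.
set c := _ ^+ _; set h := _ %/ _; set r := _ %% _.
move=> gE; have ec : e c != 0.
  by rewrite rmorphXn expf_neq0 // lead_coef_truncated.
have sr : (size r < size f)%N by rewrite Pdiv.Idomain.ltn_modp.
have evE : ev r = e c * ev g.
  by rewrite -hornerZ -map_polyZ gE rmorphD rmorphM /= hornerD hornerM evf mulr0 add0r.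
have [|v [b [eb vb]]] := inverse_up_to_base_small sr.
  by rewrite evE mulf_neq0.
exists (v * c%:P), b; split=> //.
by rewrite -vb rmorphM /= hornerM map_polyC /= hornerC evE mulrA.
Qed.

End Elimination.

(* A point of the base which kills the kernel of e and avoids the zeros of b
   extends to a point of the line over it. *)
Lemma extend_point (K : closedFieldType) (B : idomainType) (L : fieldType)
    (e : {rmorphism B -> L}) (x : L) (p : {poly B}) :
  (map_poly e p).[x] != 0 ->
  exists2 b, e b != 0 & forall phi : {rmorphism B -> K},
    (forall c, e c = 0 -> phi c = 0) -> phi b != 0 ->
    exists2 xi, forall g, (map_poly e g).[x] = 0 -> (map_poly phi g).[xi] = 0
              & (map_poly phi p).[xi] != 0.
Proof.
move=> evp.
case: (pselect (exists g : {poly B}, map_poly e g != 0 /\ (map_poly e g).[x] = 0));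
  last first.
  (* Transcendental case: only polynomials with zero image vanish at [x], so any non-root [xi] of
     [map_poly phi p] will do. One exists as soon as [phi] does not kill the coefficient of [p] that
     gives the leading coefficient of its image. *)
  move=> transc; have ker g : (map_poly e g).[x] = 0 -> map_poly e g = 0.
    by move=> h; apply/eqP; apply: contra_notT transc => h'; exists g.
  have ep : map_poly e p != 0 by apply: contraNneq evp => ->; rewrite horner0.
  exists p`_(size (map_poly e p)).-1.
    by rewrite -coef_map -lead_coefE lead_coef_eq0.
  move=> phi kerphi phib.
  have /closed_nonrootP[xi] : map_poly phi p != 0.
    apply: contraNneq phib => h.
    by rewrite -[phi _]coef_map h coef0.
  move=> xiP; exists xi => // g /ker /polyP h.
  suff -> : map_poly phi g = 0 by rewrite horner0.
  apply/polyP => i; rewrite coef0 coef_map; apply: kerphi.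
  by have := h i; rewrite coef0 coef_map.
move=> algx.
(* Algebraic case: [f] is taken with an image of least size among the nonzero ones vanishing at [x],
   a minimal polynomial up to scaling. *)
pose P k := `[< exists g : {poly B},
  [/\ map_poly e g != 0, (map_poly e g).[x] = 0 & size (map_poly e g) = k] >].
have exP : exists k, P k.
  by case: algx => g [g0 gx]; exists (size (map_poly e g)); apply/asboolP; exists g.
case: (ex_minnP exP) => k /asboolP[f0 [f00 f0x f0k]] kmin.
have [f ef sf] := truncate_poly e f0; rewrite -{}ef {f0} in f00 f0x f0k sf.
have f_neq0 : f != 0 by apply: contraNneq f00 => ->; rewrite rmorph0.
have f_min g : (size (map_poly e g) < size f)%N ->
    (map_poly e g).[x] = 0 -> map_poly e g = 0.
  rewrite sf f0k => lt gx; apply/eqP; apply: contraTT lt => g0.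
  by rewrite -leqNgt kmin //; apply/asboolP; exists g.
have el := lead_coef_truncated sf f_neq0.
have [v [b [eb vb]]] := inverse_up_to_base sf f_neq0 f0x f_min evp.
(* The factor [lead_coef f] preserves the size of [f] under [phi], which yields a root [xi]; the
   factor [b] keeps [p] from vanishing there. *)
exists (lead_coef f * b); first by rewrite rmorphM mulf_neq0.
move=> phi kerphi; rewrite rmorphM mulf_eq0 negb_or => /andP[phil phib].
have f_gt1 : (1 < size f)%N.
  rewrite ltnNge; apply: contraL el => /size1_polyC fC.
  by move: f0x; rewrite fC map_polyC hornerC lead_coefC => ->; rewrite eqxx.
have sphi : size (map_poly phi f) = size f by rewrite size_map_poly_id0.
have [|xi /rootP xif] := closed_rootP (map_poly phi f) _.
  by rewrite sphi; apply: contraTneq f_gt1 => ->.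
(* The pseudo-remainder of [g] by [f] vanishes at [x], so by minimality its coefficients die under
   [e], hence under [phi]. *)
have kerxi g : (map_poly e g).[x] = 0 -> (map_poly phi g).[xi] = 0.
  move=> gx; have := Pdiv.WeakIdomain.divp_eq g f.
  set c := _ ^+ _; set h := _ %/ _; set r := _ %% _ => gE.
  have sr : (size r < size f)%N by rewrite Pdiv.Idomain.ltn_modp.
  have /polyP er : map_poly e r = 0.
    apply: f_min; first exact: leq_ltn_trans (size_poly _ _) sr.
    have -> : r = c *: g - h * f by rewrite gE addrC addKr.
    by rewrite rmorphB /= map_polyZ rmorphM /= !hornerE gx f0x !mulr0 subrr.
  have phir : map_poly phi r = 0.
    apply/polyP => i; rewrite coef0 coef_map; apply: kerphi.
    by have := er i; rewrite coef0 coef_map.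
  have : phi c * (map_poly phi g).[xi] = 0.
    rewrite -hornerZ -map_polyZ gE rmorphD rmorphM /= hornerD hornerM phir xif.
    by rewrite horner0 mulr0 addr0.
  move/eqP; rewrite mulf_eq0 rmorphXn expf_eq0 (negbTE phil) andbF /=.
  by move/eqP.
exists xi => //; apply: contraNneq phib => pxi.
have := kerxi (v * p - b%:P); rewrite !rmorphB !rmorphM /= !map_polyC !hornerE /=.
by rewrite vb subrr pxi mulr0 sub0r => /(_ erefl) /eqP; rewrite oppr_eq0.
Qed.

Lemma mpoly_rmorph_eq (n : nat) (F : fieldType) (A : comNzRingType)
    (f g : {rmorphism {mpoly F[n]} -> A}) :
  (forall c, f c%:MP = g c%:MP) -> (forall i, f 'X_i = g 'X_i) -> f =1 g.
Proof.
move=> fgC fgX p; rewrite (mpolyE p) !rmorph_sum; apply: eq_bigr => m _ /=.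
rewrite -mul_mpolyC !rmorphM fgC mpolyXE_id !rmorph_prod; congr (_ * _).
by apply: eq_bigr => i _; rewrite !rmorphXn /= fgX.
Qed.

(** Induction on the number of variables: a point for the restriction of [e] to all variables but
    the first is lifted by [extend_point]. The kernel of [e] stands for the prime ideal. *)
Lemma mpoly_nullstellensatz (K : closedFieldType) (L : fieldType) (m : nat)
    (e : {rmorphism {mpoly K[m]} -> L}) (p : {mpoly K[m]}) :
  e p != 0 ->
  exists2 v : 'I_m -> K, forall g, e g = 0 -> g.@[v] = 0 & p.@[v] != 0.
Proof.
elim: m e p => [|m IHm] e p ep.
  have const (g : {mpoly K[0]}) : g = g.@[fun=> 0]%:MP.
    by rewrite [in RHS](nvar0_mpolyC g) mevalC -nvar0_mpolyC.
  have econst c : e c%:MP = 0 -> c = 0.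
    by move/eqP; rewrite -[e _]/((e \o @mpolyC 0 K) c) fmorph_eq0 => /eqP.
  exists (fun=> 0) => [g|]; first by rewrite {1}(const g) => /econst.
  by apply: contraNneq ep => p0; rewrite (const p) p0 !raddf0.
(* [w] embeds the ring in the remaining variables and [u] singles out the first one, so that [e]
   becomes evaluation at [e 'X_ord0]. *)
pose w : {rmorphism {mpoly K[m]} -> {mpoly K[m.+1]}} :=
  mmap (@mpolyC m.+1 K) (fun i => 'X_(lift ord0 i)).
pose u : {rmorphism {mpoly K[m.+1]} -> {poly {mpoly K[m]}}} :=
  mmap (polyC \o @mpolyC m K)
       (fun i => if unlift ord0 i is Some j then ('X_j)%:P else 'X).
pose e1 : {rmorphism {mpoly K[m]} -> L} := e \o w.
pose ev : {rmorphism {poly {mpoly K[m]}} -> L} :=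
  horner_eval (e 'X_ord0) \o map_poly e1.
have evu : ev \o u =1 e.
  apply: mpoly_rmorph_eq => [c|i] /=.
    by rewrite /horner_eval mmapC /= map_polyC hornerC /= /w /= mmapC.
  rewrite /horner_eval mmapX mmap1U; case: unliftP => [j ->|->].
    by rewrite map_polyC hornerC /= mmapX mmap1U.
  by rewrite map_polyX hornerX.
have evp : (map_poly e1 (u p)).[e 'X_ord0] != 0 by rewrite [X in X != 0]evu.
have [b eb ext] := extend_point K evp.
have [v kerv bv] := IHm e1 b eb.
have [xi kerxi pxi] := ext (meval v) kerv bv.
pose v' i := if unlift ord0 i is Some j then v j else xi.
have v'E g : (map_poly (meval v) (u g)).[xi] = g.@[v'].
  pose f1 : {rmorphism {mpoly K[m.+1]} -> K} :=
    (horner_eval xi \o map_poly (meval v)) \o u.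
  apply: (@mpoly_rmorph_eq _ _ _ f1 (meval v')) => [c|i] /=.
    by rewrite /horner_eval mmapC /= map_polyC hornerC /= !mevalC.
  rewrite /horner_eval mmapX mmap1U mevalXU /v'; case: unliftP => [j _|_].
    by rewrite map_polyC hornerC /= mevalXU.
  by rewrite map_polyX hornerX.
exists v' => [g eg|]; rewrite -v'E //.
by apply: kerxi; rewrite [LHS]evu.
Qed.

(** * Rank over the residue field *)

(** Independent rows are selected first, then independent columns of the resulting submatrix. *)
Lemma rank_minor (F : fieldType) (d : nat) (A : 'M[F]_d) :
  exists f g : 'I_(\rank A) -> 'I_d, \det (mxsub f g A) != 0.
Proof.
pose A1 := rowsub (maxrankfun A) A.
have full : row_full A1^T by rewrite /row_full mxrank_tr eq_maxrowsub.
exists (maxrankfun A), (fullrankfun full).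
rewrite -unitfE -[_ \is a _]/(_ \in unitmx) -unitmx_tr.
have -> : (mxsub (maxrankfun A) (fullrankfun full) A)^T
   = rowsub (fullrankfun full) A1^T by apply/matrixP => i j; rewrite !mxE.
exact: fullrowsub_unit.
Qed.

Lemma minor_rank (F : fieldType) (d r : nat) (A : 'M[F]_d) (f g : 'I_r -> 'I_d) :
  \det (mxsub f g A) != 0 -> (r <= \rank A)%N.
Proof.
rewrite -unitfE -[_ \is a _]/(_ \in unitmx) => /mxrank_unit <-.
have -> : mxsub f g A = rowsub f (rowsub g A^T)^T by apply/matrixP => i j; rewrite !mxE.
rewrite (leq_trans (mxrankS (rowsub_sub _ _))) // mxrank_tr -[leqRHS]mxrank_tr.
exact: mxrankS (rowsub_sub _ _).
Qed.

(** A minor that survives [phi] survives [e]: specialization cannot raise the rank. *)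
Lemma rank_map_kernel (S : comNzRingType) (L K : fieldType)
    (e : {rmorphism S -> L}) (phi : {rmorphism S -> K}) (d : nat) (A : 'M[S]_d) :
  (forall s, e s = 0 -> phi s = 0) ->
  (\rank (map_mx phi A) <= \rank (map_mx e A))%N.
Proof.
move=> ker; have [f [g]] := rank_minor (map_mx phi A).
rewrite -map_mxsub det_map_mx => minor; apply: (@minor_rank _ _ _ _ f g).
by rewrite -map_mxsub det_map_mx; apply: contraNneq minor => /ker ->.
Qed.

(** Semicontinuity: [s] is a minor of size the rank over [L] that [e] does not kill. *)
Lemma rank_map_open (S : comNzRingType) (L : fieldType)
    (e : {rmorphism S -> L}) (d : nat) (A : 'M[S]_d) :
  exists2 s, e s != 0 & forall (K : fieldType) (phi : {rmorphism S -> K}),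
    phi s != 0 -> (\rank (map_mx e A) <= \rank (map_mx phi A))%N.
Proof.
have [f [g]] := rank_minor (map_mx e A).
rewrite -map_mxsub det_map_mx => minor; exists (\det (mxsub f g A)) => // K phi.
by rewrite -det_map_mx map_mxsub; apply: minor_rank.
Qed.

Section GenericRank.
Variables (F : closedFieldType) (n : nat).
Local Notation S := {mpoly F[n * n]}.

Section ResidueMap.
Variable q : prime_idealr S.

(** The same function as [to_residue], packaged as a ring morphism. *)
Definition residue_map : {rmorphism S -> residue_field q} :=
  @FracField.tofrac {ideal_quot q} \o \pi_{ideal_quot q}%qT.

Lemma residue_map_eq0 (s : S) : (residue_map s == 0) = (s \in q).
Proof.
by rewrite /= tofrac_eq0 -[X in _ == X](rmorph0 \pi_{ideal_quot q}%qT)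
  -Quotient.idealrBE subr0.
Qed.

End ResidueMap.

Variable kappa : {symmetric 'M[F]_n}.
Hypothesis kappa_nondeg : nondegenerate kappa.

Local Notation kcoord y := (fun k => kappa (vec_mx (delta_mx 0 k)) y).

Lemma form_coordE y k :
  kappa (vec_mx (delta_mx 0 k)) y =
  \sum_l mxvec y 0 l * kappa (vec_mx (delta_mx 0 k)) (vec_mx (delta_mx 0 l)).
Proof.
rewrite -{1}(mxvecK y) {1}[mxvec y]row_sum_delta !linear_sum.
by apply: eq_bigr => l _; rewrite !linearZ.
Qed.

(** Nondegeneracy makes the Gram matrix of [kappa] on elementary matrices invertible. Hence every
    point given by the Nullstellensatz comes from a matrix. *)
Lemma form_coord_surj (v : 'I_(n * n) -> F) : exists y, kcoord y =1 v.
Proof.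
pose G : 'M[F]_(n * n) :=
  \matrix_(l, k) kappa (vec_mx (delta_mx 0 k)) (vec_mx (delta_mx 0 l)).
have GE y k : (mxvec y *m G) 0 k = kappa (vec_mx (delta_mx 0 k)) y.
  by rewrite form_coordE mxE; apply: eq_bigr => l _; rewrite [G _ _]mxE.
have Gunit : G \in unitmx.
  rewrite -row_free_unit; apply/inj_row_free => w wG.
  suff : vec_mx w \in (0%VS : {vspace 'M[F]_n}).
    by rewrite memv0 => /eqP /(congr1 mxvec); rewrite vec_mxK linear0.
  rewrite -(eqP kappa_nondeg); apply/mem_orthovP => z _.
  apply/eqP; rewrite herm_eq0C -(mxvecK z) [mxvec z]row_sum_delta linear_sum.
  rewrite linear_sumlz big1 // => k _.
  by rewrite linearZ linearZl_LR /= -GE vec_mxK wG mxE mulr0.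
exists (vec_mx (\row_k v k *m invmx G)) => k /=.
by rewrite -GE vec_mxK mulmxKV // mxE.
Qed.

Definition sym_evalr (y : 'M[F]_n) : {rmorphism S -> F} := meval (kcoord y).

(** [zariski_closure] evaluates at matrix entries and [sym_eval] at the coordinates given by
    [kappa]; a linear substitution relates the two. *)
Lemma sym_eval_polynomial (s : S) :
  exists t : S, forall y, t.@[fun k => mxvec y 0 k] = sym_eval kappa s y.
Proof.
pose w : {rmorphism S -> S} := mmap (@mpolyC (n * n) F)
  (fun k => \sum_l kappa (vec_mx (delta_mx 0 k)) (vec_mx (delta_mx 0 l)) *: 'X_l).
exists (w s) => y.
pose f : {rmorphism S -> F} := meval (fun k => mxvec y 0 k) \o w.
apply: (@mpoly_rmorph_eq _ _ _ f (sym_evalr y)) => [c|k] /=.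
  by rewrite mmapC !mevalC.
rewrite mmapX mmap1U mevalXU form_coordE raddf_sum.
by apply: eq_bigr => l _; rewrite /= mevalZ mevalXU mulrC.
Qed.

Lemma nilp_orbit_jordan (mu : seq nat) : nilp_orbit mu (jordan_mx F n mu).
Proof. by exists 1%:M; rewrite ?unitmx1 // invmx1 mulmx1 mul1mx. Qed.

(** Upper bound: a nonzero minor of maximal size over the residue field is nonzero at some zero of
    [q], hence somewhere on the orbit, whose closure contains that zero. Lower bound: evaluation at
    a point of the orbit kills [q]. *)
Lemma generic_rank (mu : seq nat) (q : prime_idealr S) (d r : nat) (A : 'M[S]_d) :
  (forall x, zero_set kappa q x <-> zariski_closure (nilp_orbit mu) x) ->
  (forall x, nilp_orbit mu x -> \rank (map_mx (sym_eval kappa ^~ x) A) = r) ->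
  \rank (map_mx (to_residue q) A) = r.
Proof.
move=> zeroq rkA; apply/eqP; rewrite eqn_leq; apply/andP; split.
  have [s s0 rk_s] := rank_map_open (residue_map q) A.
  have [v ker_v sv] := mpoly_nullstellensatz s0.
  have [y yv] := form_coord_surj v.
  have evalv p : sym_eval kappa p y = p.@[v] by apply: meval_eq.
  have [t tE] := sym_eval_polynomial s.
  have /zeroq cl_y : zero_set kappa q y.
    by move=> p pq; rewrite evalv ker_v //; apply/eqP; rewrite residue_map_eq0.
  have [x Ox sx] : exists2 x, nilp_orbit mu x & sym_eval kappa s x != 0.
    apply: contrapT => none; move: sv; rewrite -evalv -tE cl_y ?eqxx // => x Ox.
    by rewrite tE; apply/eqP; apply: contra_notT none => h; exists x.
  by rewrite -(rkA x Ox); apply: (rk_s _ (sym_evalr x)).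
have Ox := nilp_orbit_jordan mu.
rewrite -(rkA _ Ox); apply: (rank_map_kernel (e := residue_map q) (phi := sym_evalr _)).
move=> s /eqP; rewrite residue_map_eq0; apply: (zeroq _).2.
by move=> p; apply.
Qed.

End GenericRank.

(** * Invariant forms *)

Section InvariantForm.
Variables (F : fieldType) (n : nat) (kappa : {symmetric 'M[F]_n}).
Hypothesis char2 : 2%:R != 0 :> F.
Hypothesis kappa_nondeg : nondegenerate kappa.
Hypothesis kappa_inv : invariant_form kappa.

Local Notation E := (@delta_mx F n n).

Lemma mxtrace_mul_delta (x : 'M[F]_n) i j : \tr (x *m E i j) = x j i.
Proof.
rewrite mxtrace_mulC /mxtrace (bigD1 i) //= big1 => [|k ki].
  rewrite mxE (bigD1 j) //= !mxE !eqxx mul1r big1 ?addr0 // => l lj.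
  by rewrite mxE (negbTE lj) andbF mul0r.
by rewrite mxE big1 // => l _; rewrite mxE (negbTE ki) mul0r.
Qed.

Section Eigenvector.
Variable al : F.

(** Eigenvectors, of eigenvalue [al], of the endomorphism that expresses [kappa] through the trace
    form. *)
Definition trace_like (z : 'M[F]_n) := forall x, kappa x z = al * \tr (x *m z).

(** Both forms are invariant, so that endomorphism commutes with brackets. *)
Lemma trace_like_bracket w z :
  trace_like z -> trace_like (w *m z - z *m w).
Proof.
move=> zP x; rewrite -kappa_inv zP mulmxBl mulmxBr !raddfB /=.
by rewrite !mulmxA (mxtrace_mulC _ w) !mulmxA.
Qed.

Lemma trace_likeZ c z : trace_like z -> trace_like (c *: z).
Proof.
by move=> zP x; rewrite linearZ /= zP -scalemxAr mxtraceZ mulrCA.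
Qed.

Lemma trace_likeZ_inv c z : c != 0 -> trace_like (c *: z) -> trace_like z.
Proof.
by move=> c0 /(trace_likeZ c^-1); rewrite scalerA mulVf // scale1r.
Qed.

Lemma trace_like_sum (I : finType) (z : I -> 'M[F]_n) :
  (forall i, trace_like (z i)) -> trace_like (\sum_i z i).
Proof.
move=> zP x; rewrite linear_sum mulmx_sumr raddf_sum mulr_sumr.
by apply: eq_bigr => i _; apply: zP.
Qed.

Lemma trace_like0 : trace_like 0.
Proof. by move=> x; rewrite linear0 mulmx0 mxtrace0 mulr0. Qed.

(** Brackets generate sl(n) from a single off-diagonal elementary matrix: first row [a], then the
    matrices [E i j] corrected by [E a a] on the diagonal, then column [a]. *)
Lemma trace_like_traceless a b : a != b -> trace_like (E a b) ->
  forall y, \tr y = 0 -> trace_like y.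
Proof.
move=> ab Eab.
have row j : a != j -> trace_like (E a j).
  move=> aj; have [->//|bj] := eqVneq j b.
  have := trace_like_bracket (E b j) Eab; rewrite !mul_delta_mx_cond.
  rewrite eqxx eq_sym (negbTE aj) sub0r => /(trace_likeZ (-1)).
  by rewrite scaleN1r opprK.
have blk i j : a != j -> trace_like (E i j - E a a *+ (i == j)).
  move=> aj; have := trace_like_bracket (E i a) (row j aj).
  by rewrite !mul_delta_mx_cond eqxx (eq_sym j).
(* The bracket of [E i a] with [E i i - E a a] is [- 2 E i a], whence the condition on the
   characteristic. *)
have col i : a != i -> trace_like (E i a).
  move=> ai; have := trace_like_bracket (E i a) (blk i i ai).
  rewrite eqxx mulmxBl mulmxBr !mul_delta_mx_cond !eqxx (negbTE ai) sub0r subr0.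
  rewrite -opprD -mulr2n -scaler_nat -scaleNr; apply: trace_likeZ_inv.
  by rewrite oppr_eq0.
move=> y try0.
(* The corrections add up to [\tr y *: E a a], which is zero. *)
have -> : y = \sum_i \sum_j y i j *: (E i j - E a a *+ (i == j)).
  under eq_bigr do under eq_bigr do rewrite scalerBr.
  under eq_bigr do rewrite sumrB.
  rewrite sumrB -matrix_sum_delta.
  suff -> : \sum_i \sum_j y i j *: (E a a *+ (i == j)) = \tr y *: E a a.
    by rewrite try0 scale0r subr0.
  rewrite /mxtrace scaler_suml; apply: eq_bigr => i _.
  rewrite (bigD1 i) //= eqxx big1 ?addr0 // => j; rewrite eq_sym => /negbTE ->.
  by rewrite mulr0n scaler0.
apply: trace_like_sum => i; apply: trace_like_sum => j; apply: trace_likeZ.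
have [<-|aj] := eqVneq a j; last exact: blk.
have [<-|ai] := eqVneq a i; first by rewrite subrr; apply: trace_like0.
by rewrite subr0; apply: col.
Qed.

End Eigenvector.

(** A weight argument: invariance under [E a a] and [E b b] gives two eigenvalue equations for
    [kappa (E j i) (E a b)], which vanishes unless [i = a] and [j = b]. *)
Lemma trace_like_delta a b : a != b -> trace_like (kappa (E b a) (E a b)) (E a b).
Proof.
move=> ab; have ba : b != a by rewrite eq_sym.
pose t i j := kappa (E j i) (E a b).
have ta i j : t i j = ((i == a)%:R - (j == a)%:R) * t i j.
  have := kappa_inv (E j i) (E a a) (E a b).
  rewrite !mul_delta_mx_cond eqxx (negbTE ba) subr0 -/(t i j) => h.
  rewrite -[LHS]h {h}.
  rewrite linearBl /= -!(scaler_nat _ (E _ _)) !linearZl_LR /= mulrBl (eq_sym a j).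
  by congr (_ - _); case: eqVneq => [->|]; rewrite ?mul0r.
have tb i j : - t i j = ((i == b)%:R - (j == b)%:R) * t i j.
  have := kappa_inv (E j i) (E b b) (E a b).
  rewrite !mul_delta_mx_cond eqxx (negbTE ba) sub0r linearN /= -/(t i j) => h.
  rewrite -[LHS]h {h}.
  rewrite linearBl /= -!(scaler_nat _ (E _ _)) !linearZl_LR /= mulrBl (eq_sym b j).
  by congr (_ - _); case: eqVneq => [->|]; rewrite ?mul0r.
have t0 i j : (i, j) != (a, b) -> t i j = 0.
  rewrite xpair_eqE; have := ta i j; have := tb i j.
  have [->|ia] := eqVneq i a; have [->|ja] := eqVneq j a.
  - by move=> _ ->; rewrite subrr mul0r.
  - rewrite (negbTE ab); case: (j == b) => //=.
    by rewrite subrr mul0r => /eqP; rewrite oppr_eq0 => /eqP.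
  (* For [j = a] and [i != a] the equation reads [t i a = - t i a]. *)
  - move=> _ /eqP; rewrite sub0r mulN1r -addr_eq0 -mulr2n -mulr_natl mulf_eq0.
    by rewrite (negbTE char2) => /eqP.
  - by move=> _ ->; rewrite subrr mul0r.
move=> x; rewrite mxtrace_mul_delta {1}[x]matrix_sum_delta linear_sumlz.
rewrite (bigD1 b) //= [X in _ + X]big1 ?addr0 => [|i ib].
  rewrite linear_sumlz (bigD1 a) //= [X in _ + X]big1 ?addr0 => [|j ja].
    by rewrite linearZl_LR /= mulrC.
  by rewrite linearZl_LR /= -/(t j b) t0 ?mulr0 // xpair_eqE (negbTE ja).
rewrite linear_sumlz big1 // => j _.
by rewrite linearZl_LR /= -/(t j i) t0 ?mulr0 // xpair_eqE (negbTE ib) andbF.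
Qed.

(** An invariant form may also contain a multiple of [\tr x * \tr y], invisible for traceless [y];
    points of a nilpotent orbit are traceless. The scalar is nonzero, since otherwise [E a b] would
    lie in the radical of [kappa]. *)
Lemma invariant_form_trace : (1 < n)%N ->
  exists2 al, al != 0 & forall x y, \tr y = 0 -> kappa x y = al * \tr (x *m y).
Proof.
move=> n_gt1; pose a := Ordinal (ltnW n_gt1); pose b := Ordinal n_gt1.
have ab : a != b by [].
exists (kappa (E b a) (E a b)) => [|x y y0].
  apply/eqP => al0; have : E a b \in (0%VS : {vspace 'M[F]_n}).
    rewrite -(eqP kappa_nondeg); apply/mem_orthovP => z _.
    by apply/eqP; rewrite herm_eq0C (trace_like_delta ab) al0 mul0r.
  rewrite memv0 => /eqP/matrixP/(_ a b); rewrite !mxE !eqxx => /eqP.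
  by rewrite oner_eq0.
exact: (trace_like_traceless ab (trace_like_delta ab)).
Qed.

End InvariantForm.

(** * Anticommutator with a Jordan matrix *)

(** Allows bases indexed by any finite type, such as the triples (block, block, diagonal) below. *)
Lemma dim_indexed_basis (F : fieldType) (vT : vectType F) (I : finType)
    (B : I -> vT) (U : {vspace vT}) :
  (forall u, B u \in U) ->
  (forall x, x \in U -> exists c : I -> F, x = \sum_u c u *: B u) ->
  (forall c : I -> F, \sum_u c u *: B u = 0 -> forall u, c u = 0) ->
  \dim U = #|I|.
Proof.
move=> BU spanB freeB; pose X := [tuple B (enum_val i) | i < #|I|].
have sumX (c : 'I_#|I| -> F) :
    \sum_i c i *: X`_i = \sum_u c (enum_rank u) *: B u.
  rewrite (reindex (@enum_val I predT)) /=; last first.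
    by exists enum_rank => i _; rewrite ?enum_valK ?enum_rankK.
  by apply: eq_bigr => i _; rewrite enum_valK -(tnth_nth 0 X i) tnth_mktuple.
suff /vector.size_basis : basis_of U X by [].
apply/andP; split.
  rewrite eqEsubv; apply/andP; split.
    by apply/span_subvP => _ /mapP[i _ ->].
  apply/subvP => x /spanB[c ->]; apply: memv_suml => u _; apply: memvZ.
  by apply/memv_span/mapP; exists (enum_rank u); rewrite ?mem_enum ?enum_rankK.
apply/freeP => c; rewrite sumX => /freeB h i.
by have := h (enum_val i); rewrite enum_valK.
Qed.

Section JordanBlocks.
Variables (F : fieldType) (n : nat) (mu : seq nat).
Hypothesis sum_mu : sumn mu = n.

Local Notation J := (jordan_mx F n mu).
Local Notation blk i := (reshape_index mu i).
Local Notation off i := (reshape_offset mu i).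
Local Notation len p := (nth 0%N mu p).

(** The distance to the end of the block, zero at its last position; for an index below [n] the
    subtraction is exact. *)
Definition co_offset (j : nat) : nat := len (blk j) - (off j).+1.

Lemma offset_lt (i : 'I_n) : (off i < len (blk i))%N.
Proof. by apply: reshape_offsetP; rewrite sum_mu. Qed.

Lemma co_offsetK (i : 'I_n) : (off i + co_offset i).+1 = len (blk i).
Proof. by rewrite -addSn subnKC // offset_lt. Qed.

Lemma block_position p s : (s < len p)%N ->
  exists2 i : 'I_n, blk i = p & off i = s.
Proof.
move=> sp; have lt := flatten_indexP sp; rewrite sum_mu in lt.
by exists (Ordinal lt) => /=; rewrite ?flatten_indexKl ?flatten_indexKr.
Qed.

Lemma block_position_inj (i j : 'I_n) : blk i = blk j -> off i = off j -> i = j.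
Proof.
by move=> b o; apply/val_inj; rewrite /= -(reshape_indexK mu i) b o reshape_indexK.
Qed.

Lemma jordan_mxE (i j : 'I_n) :
  J i j = ((blk j == blk i) && (off j == (off i).+1))%:R.
Proof.
rewrite mxE; congr (nat_of_bool _)%:R; rewrite [RHS]andbC eq_sym [in RHS]eq_sym.
have [e|] := eqVneq (blk i) (blk j); rewrite ?andbF // !andbT.
rewrite -{1}(reshape_indexK mu i) -{1}(reshape_indexK mu j) /flatten_index e.
by rewrite -addnS eqn_add2l.
Qed.

(** Within blocks, left multiplication by [J] moves rows up by one and right multiplication moves
    columns right by one. The vacated last row and first column of each block are zero. *)
Lemma jordan_mull_last (x : 'M[F]_n) (i j : 'I_n) : co_offset i = 0%N -> (J *m x) i j = 0.
Proof.
move=> last; rewrite mxE big1 // => k _; rewrite jordan_mxE.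
case: andP => [[/eqP b /eqP o]|_]; last by rewrite mul0r.
by have := offset_lt k; rewrite b o -co_offsetK last addn0 ltnn.
Qed.

Lemma jordan_mull (x : 'M[F]_n) (i i' j : 'I_n) : blk i' = blk i ->
  off i' = (off i).+1 -> (J *m x) i j = x i' j.
Proof.
move=> b o; rewrite mxE (bigD1 i') //= jordan_mxE b o !eqxx mul1r big1 ?addr0 //.
move=> k ki'; rewrite jordan_mxE; case: andP => [[/eqP kb /eqP ko]|_].
  by case/eqP: ki'; apply: block_position_inj; rewrite ?b ?o.
by rewrite mul0r.
Qed.

Lemma jordan_mulr_first (x : 'M[F]_n) (i j : 'I_n) : off j = 0%N -> (x *m J) i j = 0.
Proof.
move=> first; rewrite mxE big1 // => k _; rewrite jordan_mxE first.
by rewrite andbF mulr0.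
Qed.

Lemma jordan_mulr (x : 'M[F]_n) (i j j' : 'I_n) : blk j = blk j' ->
  off j = (off j').+1 -> (x *m J) i j = x i j'.
Proof.
move=> b o; rewrite mxE (bigD1 j') //= jordan_mxE b o !eqxx mulr1 big1 ?addr0 //.
move=> k ki'; rewrite jordan_mxE; case: andP => [[/eqP kb /eqP ko]|_].
  case/eqP: ki'; apply: block_position_inj; first by rewrite -b -kb.
  by move: ko; rewrite o => -[].
by rewrite mulr0.
Qed.

Lemma block_next (i : 'I_n) : (0 < co_offset i)%N ->
  exists i' : 'I_n, [/\ blk i' = blk i, off i' = (off i).+1
                      & (co_offset i').+1 = co_offset i].
Proof.
move=> next; have [|i' b o] := @block_position (blk i) (off i).+1.
  by rewrite -co_offsetK ltnS -{1}[off i]addn0 ltn_add2l.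
exists i'; split => //; apply: (@addnI (off i)); apply: succn_inj.
by rewrite addnS -addSn -o !co_offsetK b.
Qed.

Lemma block_prev (j : 'I_n) : (0 < off j)%N ->
  exists j' : 'I_n, [/\ blk j = blk j', off j = (off j').+1
                      & co_offset j' = (co_offset j).+1].
Proof.
move=> prev; have [|j' b o] := @block_position (blk j) (off j).-1.
  by rewrite (leq_ltn_trans (leq_pred _)) ?offset_lt.
have oj : off j = (off j').+1 by rewrite o prednK.
exists j'; split => //; apply: (@addnI (off j')); apply: succn_inj.
by rewrite co_offsetK addnS -addSn -oj co_offsetK b.
Qed.

Definition anticomm (y x : 'M[F]_n) : 'M[F]_n := y *m x + x *m y.

Lemma anticomm_is_linear y : linear (anticomm y).
Proof.
move=> c u v; rewrite /anticomm mulmxDr mulmxDl -scalemxAl -scalemxAr.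
by rewrite scalerDr addrACA.
Qed.
HB.instance Definition _ y := GRing.isLinear.Build F 'M[F]_n 'M[F]_n _
  (anticomm y) (anticomm_is_linear y).

Section Kernel.
Variable x : 'M[F]_n.
Hypothesis Jx : anticomm J x = 0.

Lemma kernel_entry i j : (J *m x) i j + (x *m J) i j = 0.
Proof. by have /matrixP/(_ i j) := Jx; rewrite !mxE. Qed.

(** In the kernel, entries change sign from one step to the next along each diagonal of a block.
    Going up and left, this diagonal leaves through the first column, where the entry is zero. *)
Lemma kernel_below (i j : 'I_n) : (off j < off i)%N -> x i j = 0.
Proof.
have [k] := ubnP (off j); elim: k i j => // k IHk i j jk ji.
have [i' [bi oi _]] := block_prev (leq_ltn_trans (leq0n _) ji).
have := kernel_entry i' j; rewrite (jordan_mull _ _ bi oi).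
have [j0|j0] := posnP (off j); first by rewrite jordan_mulr_first ?addr0.
have [j' [bj oj _]] := block_prev j0.
rewrite (jordan_mulr _ _ bj oj) (IHk i' j') ?addr0 //; first by rewrite -ltnS -oj.
by rewrite -ltnS -oj -oi.
Qed.

(** The same argument going down and right, where the diagonal leaves through the last row. *)
Lemma kernel_above (i j : 'I_n) : (co_offset i < co_offset j)%N -> x i j = 0.
Proof.
have [k] := ubnP (co_offset i); elim: k i j => // k IHk i j ik ij.
have [j' [bj oj cj]] := block_next (leq_ltn_trans (leq0n _) ij).
have := kernel_entry i j'; rewrite (jordan_mulr _ _ bj oj).
have [i0|i0] := posnP (co_offset i); first by rewrite jordan_mull_last ?add0r.
have [i' [bi oi ci]] := block_next i0.
rewrite (jordan_mull _ _ bi oi) (IHk i' j') ?add0r //; first by rewrite -ltnS ci.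
by rewrite -ltnS ci cj.
Qed.

(** On the remaining diagonals, each entry is determined by the one in the last column of the block,
    [co_offset j] steps away. *)
Lemma kernel_diagonal (i j k l : 'I_n) :
  blk k = blk i -> blk l = blk j -> co_offset l = 0%N ->
  off k = (off i + co_offset j)%N -> x i j = (-1) ^+ co_offset j * x k l.
Proof.
have [m] := ubnP (co_offset j); elim: m i j => // m IHm i j jm bk bl l0 ok.
have [j0|j0] := posnP (co_offset j).
  have -> : k = i by apply: block_position_inj; rewrite // ok j0 addn0.
  suff -> : l = j by rewrite j0 expr0 mul1r.
  apply: block_position_inj => //; apply: succn_inj.
  by rewrite -[off l]addn0 -[off j]addn0 -{1}l0 -j0 !co_offsetK bl.
have [j' [bj oj cj]] := block_next j0.
have i0 : (0 < co_offset i)%N.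
  rewrite -(ltn_add2l (off i)) addn0 -ltnS co_offsetK -bk.
  by rewrite (leq_trans _ (offset_lt k)) // ok ltnS -addn1 leq_add2l.
have [i' [bi oi ci]] := block_next i0.
have := kernel_entry i j'; rewrite (jordan_mull _ _ bi oi) (jordan_mulr _ _ bj oj).
move/eqP; rewrite addr_eq0 => /eqP /esym /(congr1 -%R); rewrite opprK => ->.
rewrite (IHm i' j') ?bi ?bj //; last by rewrite ok oi -cj addSnnS.
  by rewrite -cj exprS mulN1r mulNr.
by rewrite -ltnS cj.
Qed.

End Kernel.

Local Notation index_triple := ('I_(size mu) * 'I_(size mu) * 'I_n)%type.

(** The range of the diagonal number depends on the two blocks, so the index set is cut out of a
    product of fixed ordinals. *)
Definition short_triple (u : index_triple) : bool :=
  (u.2 < len u.1.1)%N && (u.2 < len u.1.2)%N.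

Local Notation triple := {u : index_triple | short_triple u}.

(* On the block (p, q) the kernel consists of the matrices whose entry (s, t) is
   (-1)^s c_k with k = s + (mu_q - 1 - t), which is constant along diagonals,
   and c_k = 0 unless k < min(mu_p, mu_q). *)
Definition kernel_basis (u : triple) : 'M[F]_n :=
  \matrix_(i, j) ((-1) ^+ off i * [&& blk i == (val u).1.1, blk j == (val u).1.2
                    & (off i + co_offset j == (val u).2)%N]%:R).

(** Inside a block the two products cancel by the alternating sign. Where only one of them survives,
    a nonzero entry would force the diagonal number to reach one of the two block lengths. *)
Lemma kernel_basis_mem u : anticomm J (kernel_basis u) = 0.
Proof.
have /andP[up uq] := valP u.
apply/matrixP => i j; rewrite [in LHS]mxE [RHS]mxE.
have [i0|i0] := posnP (co_offset i); last first.
  have [i' [bi oi ci]] := block_next i0.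
  rewrite (jordan_mull _ _ bi oi) mxE bi oi.
  have [j0|j0] := posnP (off j); last first.
    have [j' [bj oj cj]] := block_prev j0.
    rewrite (jordan_mulr _ _ bj oj) mxE bj cj addSnnS exprS -mulrA.
    by rewrite mulN1r addNr.
  rewrite jordan_mulr_first // addr0; case: and3P; rewrite ?mulr0 //.
  case=> _ /eqP jq /eqP e; move: uq; rewrite -jq -e -co_offsetK j0 add0n.
  by rewrite addSn ltnS ltnNge leq_addl.
rewrite jordan_mull_last // add0r.
have [j0|j0] := posnP (off j); first by rewrite jordan_mulr_first.
have [j' [bj oj cj]] := block_prev j0.
rewrite (jordan_mulr _ _ bj oj) mxE; case: and3P; rewrite ?mulr0 //.
case=> /eqP ip _ /eqP e; move: up; rewrite -ip -e -co_offsetK i0 addn0 cj.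
by rewrite addnS ltnS ltnNge leq_addr.
Qed.

Lemma triple_eq (u v : triple) : (val u).1.1 = (val v).1.1 :> nat ->
  (val u).1.2 = (val v).1.2 :> nat -> (val u).2 = (val v).2 :> nat -> u = v.
Proof.
case: u v => [[[p q] k] hu] [[[p' q'] k'] hv] /= e1 e2 e3; apply/val_inj => /=.
by congr (_, _, _); apply/val_inj.
Qed.

(** This entry, in the last column of a block, is a sign for [kernel_basis u] and zero for the other
    basis matrices, so it reads off the coefficient of [u]. *)
Lemma triple_entry (u : triple) : exists ij : 'I_n * 'I_n,
  [/\ blk ij.1 = (val u).1.1, blk ij.2 = (val u).1.2,
      off ij.1 = (val u).2 & co_offset ij.2 = 0%N].
Proof.
have /andP[up uq] := valP u; have [i bi oi] := block_position up.
have [|j bj oj] := @block_position (val u).1.2 (len (val u).1.2).-1.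
  by case: (len _) uq.
exists (i, j); split=> //=; rewrite /co_offset bj oj.
by rewrite prednK ?subnn // (leq_ltn_trans (leq0n _) uq).
Qed.

Lemma kernel_dim : \dim (lker (linfun (anticomm J))) = #|short_triple|.
Proof.
rewrite -card_sig; apply: (dim_indexed_basis (B := kernel_basis)) => [u|x|c].
- by rewrite memv_ker lfunE /= kernel_basis_mem.
- rewrite memv_ker lfunE /= => /eqP Jx.
  pose ij (u : triple) := projT1 (cid (triple_entry u)).
  have ijP (u : triple) := projT2 (cid (triple_entry u)).
  exists (fun u : triple => (-1) ^+ (val u).2 * x (ij u).1 (ij u).2).
  apply/matrixP => i j; rewrite summxE.
  under eq_bigr do rewrite !mxE.
  (* Outside this range the entry is zero by [kernel_above] or [kernel_below]; inside it exactly one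
     triple contributes. *)
  have [lt|ge] := boolP ((off i + co_offset j < len (blk i)) &&
                          (off i + co_offset j < len (blk j)))%N; last first.
    rewrite big1 => [|u _].
      move: ge; rewrite -!co_offsetK !ltnS leq_add2l leq_add2r.
      by rewrite negb_and -!ltnNge => /orP[/kernel_above|/kernel_below]; apply.
    case: and3P => [[/eqP bi /eqP bj /eqP e]|]; last by rewrite !mulr0.
    by move: ge; rewrite bi bj e [_ && _](valP u).
  have bi : (blk i < size mu)%N by rewrite reshape_indexP ?sum_mu.
  have bj : (blk j < size mu)%N by rewrite reshape_indexP ?sum_mu.
  have kn : (off i + co_offset j < n)%N.
    case/andP: lt => /block_position[k _ <-] _.
    by rewrite (leq_ltn_trans _ (ltn_ord k)) // leq_subr.
  pose u0 : triple := Sub (Ordinal bi, Ordinal bj, Ordinal kn) lt.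
  have [/= b1 b2 o1 o2] := ijP u0.
  rewrite (bigD1 u0) //= big1 ?addr0 => [|u uu0].
    rewrite !eqxx mulr1 mulrAC -exprD addnAC addnn exprD -muln2 exprM.
    rewrite sqrr_sign mul1r.
    exact: (kernel_diagonal Jx b1 b2 o2 o1).
  case: and3P => [[/eqP eu1 /eqP eu2 /eqP eu3]|]; last by rewrite !mulr0.
  by case/eqP: uu0; apply: triple_eq; rewrite /= ?eu1 ?eu2 ?eu3.
move=> c0 u; have [[i j] /= [bi bj oi j0]] := triple_entry u.
have /matrixP/(_ i j) := c0; rewrite summxE mxE.
under eq_bigr do rewrite !mxE.
rewrite (bigD1 u) //= big1 ?addr0 => [|v uv].
  rewrite bi bj oi j0 addn0 !eqxx mulr1 => /eqP; rewrite mulf_eq0 signr_eq0 orbF.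
  by move/eqP.
case: and3P => [[/eqP e1 /eqP e2 /eqP e3]|]; last by rewrite !mulr0.
by case/eqP: uv; apply: triple_eq; rewrite -?e1 -?e2 -?e3 ?bi ?bj ?oi ?j0 ?addn0.
Qed.

(** Counted by [k]: the admissible pairs are pairs of parts greater than [k], and
    [dual_part mu k.+1] counts such parts. *)
Lemma card_short_triple :
  #|short_triple| = (\sum_(1 <= i < n.+1) dual_part mu i ^ 2)%N.
Proof.
rewrite big_add1 /= big_mkord -sum1_card.
rewrite (eq_bigl (fun u : index_triple => true && short_triple u)) //.
rewrite -(pair_big_dep xpredT (fun pq k => short_triple (pq, k)) (fun _ _ => 1%N)) /=.
rewrite (exchange_big_dep xpredT) //=; apply: eq_bigr => k _.
have -> : dual_part mu k.+1 = (\sum_(p < size mu | (k < len p)%N) 1)%N.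
  rewrite /dual_part -sum1_count (big_nth 0%N) big_mkord.
  by [].
rewrite -mulnn big_distrlr /= pair_big_dep /=.
by apply: eq_bigl => -[p q].
Qed.

(** The witness has ones just below the diagonal, in the rows of odd offset. Then [J *m x] is the
    projector on even offsets and [x *m J] the one on odd offsets; even lengths ensure that the last
    offset of a block is odd. *)
Lemma jordan_anticomm_one : ~~ has odd mu ->
  exists2 x, anticomm J x = 1%:M & \tr x = 0.
Proof.
move=> mu_even; have len_even p : ~~ odd (len p).
  case: (ltnP p (size mu)) => [ps|/(nth_default 0%N)-> //].
  by apply: contra mu_even => lp; apply/hasP; exists (len p); rewrite ?mem_nth.
pose x : 'M[F]_n := \matrix_(i, j)
  [&& odd (off i), blk i == blk j & off i == (off j).+1]%:R.
have eqij (i j : 'I_n) : ((blk i == blk j) && (off i == off j) = (i == j)).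
  apply/andP/eqP => [[/eqP bij /eqP oij]|->]; last by rewrite !eqxx.
  exact: block_position_inj bij oij.
exists x; last by rewrite /mxtrace big1 // => i _; rewrite mxE (ltn_eqF (ltnSn _)) !andbF.
apply/matrixP => i j; rewrite [in LHS]mxE [RHS]mxE -eqij.
have -> : (J *m x) i j = (~~ odd (off i) && ((blk i == blk j) && (off i == off j)))%:R.
  have [i0|i0] := posnP (co_offset i); last first.
    have [i' [bi oi ci]] := block_next i0.
    by rewrite (jordan_mull _ _ bi oi) mxE bi oi.
  rewrite jordan_mull_last //.
  by have := len_even (blk i); rewrite -co_offsetK i0 addn0 /= negbK => ->.
have -> : (x *m J) i j = (odd (off i) && ((blk i == blk j) && (off i == off j)))%:R.
  have [j0|j0] := posnP (off j); last first.
    have [j' [bj oj cj]] := block_prev j0.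
    by rewrite (jordan_mulr _ _ bj oj) mxE bj oj.
  rewrite jordan_mulr_first // j0; case: (off i) => [|o] //=.
  by rewrite !andbF.
by case: odd; rewrite ?add0r ?addr0.
Qed.

Lemma sum_sign (m : nat) : \sum_(s < m) (-1) ^+ s = (odd m)%:R :> F.
Proof.
elim: m => [|m IHm]; first by rewrite big_ord0.
rewrite big_ord_recr /= IHm -signr_odd; case: odd => /=.
  by rewrite expr1 subrr.
by rewrite expr0 add0r.
Qed.

(** An alternating diagonal of signs on one block of odd length anticommutes with [J]; its trace is
    the alternating sum, equal to 1. *)
Lemma jordan_anticomm_trace : has odd mu ->
  exists2 z, anticomm J z = 0 & \tr z != 0.
Proof.
case/(has_nthP 0%N) => p ps odd_p.
pose d : 'rV[F]_n := \row_i ((-1) ^+ off i * (blk i == p)%:R).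
exists (diag_mx d).
  rewrite /anticomm mul_mx_diag mul_diag_mx; apply/matrixP => i j.
  rewrite mxE [X in X + _]mxE [X in _ + X]mxE jordan_mxE [RHS]mxE ![d _ _]mxE.
  have [/andP[/eqP -> /eqP ->]|] := boolP (_ && _); last by rewrite !(mul0r, mulr0) addr0.
  by rewrite mul1r mulr1 exprS mulN1r mulNr addNr.
suff -> : \tr (diag_mx d) = 1 by apply: oner_neq0.
rewrite mxtrace_diag; under eq_bigr do rewrite mxE.
have blk_off (s : 'I_(len p)) : (flatten_index mu p s < n)%N.
  by rewrite -sum_mu flatten_indexP.
under eq_bigr do rewrite mulr_natr mulrb; rewrite -big_mkcond /=.
have off_lt (i : 'I_n) : blk i = p -> (off i < len p)%N by move=> <-; apply: offset_lt.
have [s0 _] : exists s0 : 'I_(len p), true.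
  by case: (len p) odd_p => // m _; exists ord0.
rewrite (reindex_onto (fun s : 'I_(len p) => Ordinal (blk_off s))
  (fun i => insubd s0 (off i))) /=.
  transitivity (\sum_(s < len p) (-1) ^+ s : F); last by rewrite sum_sign odd_p.
  apply: eq_big => [s|s _]; last by rewrite flatten_indexKr.
  by rewrite flatten_indexKl // flatten_indexKr // eqxx valKd /= eqxx.
move=> i /eqP bi; apply/val_inj => /=.
by rewrite val_insubd off_lt // -[in LHS]bi reshape_indexK.
Qed.

End JordanBlocks.

Lemma kernel_dim_dual (F : fieldType) (n : nat) (mu : seq nat) : sumn mu = n ->
  \dim (lker (linfun (anticomm (jordan_mx F n mu)))) =
  (\sum_(1 <= i < n.+1) dual_part mu i ^ 2)%N.
Proof. by move=> sum_mu; rewrite kernel_dim // card_short_triple. Qed.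

(** Rank-nullity: coordinates in [b] identify [rad] with the left kernel of the Gram matrix, where
    [f j] is pairing with the [j]-th basis vector. *)
Lemma gram_rank (F : fieldType) (V : vectType F) (d : nat) (b : d.-tuple V)
    (f : 'I_d -> V -> F) (rad : {vspace V}) :
  free b ->
  (forall j (c : 'I_d -> F), f j (\sum_i c i *: b`_i) = \sum_i c i * f j (b`_i)) ->
  (forall x, x \in rad <-> x \in <<b>>%VS /\ forall j, f j x = 0) ->
  (\rank (\matrix_(i < d, j < d) f j (b`_i)%R) + \dim rad)%N = d.
Proof.
move=> free_b f_lin radP; set G := (X in \rank X).
pose N := row_base (kermx G).
pose comb (w : 'rV[F]_d) := \sum_i w 0 i *: b`_i.
have combG w j : f j (comb w) = (w *m G) 0 j.
  by rewrite f_lin mxE; apply: eq_bigr => i _; rewrite mxE.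
have comb_mem w : comb w \in <<b>>%VS.
  by apply: memv_suml => i _; apply/memvZ/memv_span/mem_nth; rewrite size_tuple.
have sum_comb (I : finType) (c : I -> F) (w : I -> 'rV[F]_d) :
    \sum_u c u *: comb (w u) = comb (\sum_u c u *: w u).
  under eq_bigr do rewrite scaler_sumr.
  rewrite exchange_big; apply: eq_bigr => i _ /=.
  rewrite summxE scaler_suml; apply: eq_bigr => u _.
  by rewrite scalerA mxE.
have NG : N *m G = 0.
  by apply/eqP; rewrite -sub_kermx eq_row_base.
suff -> : \dim rad = #|'I_(\rank (kermx G))|.
  by rewrite card_ord mxrank_ker addnC subnK // rank_leq_row.
apply: (dim_indexed_basis (B := fun u => comb (row u N))) => [u|x|c].
- apply/radP; split=> // j; rewrite combG -row_mul NG.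
  by rewrite mxE mxE.
- case/radP => xb fx; pose w : 'rV[F]_d := \row_i coord b i x.
  have xE : x = comb w.
    by rewrite [LHS](coord_span xb); apply: eq_bigr => i _; rewrite mxE.
  have : (w <= N)%MS.
    rewrite eq_row_base sub_kermx; apply/eqP/rowP => j.
    by rewrite -combG -xE fx mxE.
  case/submxP => c cE; exists (fun u => c 0 u).
  by rewrite sum_comb -mulmx_sum_row -cE.
- rewrite sum_comb => h u; have c0 := elimT freeP free_b _ h.
  have : \row_v c v *m N = 0.
    have -> : \row_v c v *m N = \sum_u c u *: row u N.
      by rewrite mulmx_sum_row; apply: eq_bigr => v _; rewrite mxE.
    by apply/rowP => i; rewrite [RHS]mxE; apply: c0.
  move/eqP; rewrite mulmx_free_eq0 ?row_base_free // => /eqP /rowP /(_ u).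
  by rewrite !mxE.
Qed.

(** * Conjugation, for passing from the Jordan matrix to its orbit *)

Section Conjugation.
Variables (F : fieldType) (n : nat) (g : 'M[F]_n).
Hypothesis g_unit : g \in unitmx.

Definition conj_mx (x : 'M[F]_n) : 'M[F]_n := g *m x *m invmx g.

Lemma conj_mx_is_linear : linear conj_mx.
Proof. by move=> c u v; rewrite /conj_mx mulmxDr mulmxDl -scalemxAr -scalemxAl. Qed.
HB.instance Definition _ := GRing.isLinear.Build F 'M[F]_n 'M[F]_n _
  conj_mx conj_mx_is_linear.

Lemma conj_mxM x y : conj_mx x *m conj_mx y = conj_mx (x *m y).
Proof. by rewrite /conj_mx !mulmxA mulmxKV. Qed.

Lemma conj_mx_inj : injective conj_mx.
Proof.
move=> x y /(congr1 (fun z => invmx g *m z *m g)).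
by rewrite /conj_mx !mulmxA !mulVmx // !mul1mx !mulmxKV.
Qed.

Lemma conj_mx_anticomm y x : anticomm (conj_mx y) (conj_mx x) = conj_mx (anticomm y x).
Proof. by rewrite /anticomm !conj_mxM -linearD. Qed.

Lemma mxtrace_conj x : \tr (conj_mx x) = \tr x.
Proof. by rewrite /conj_mx mxtrace_mulC mulmxA mulVmx // mul1mx. Qed.

Lemma conj_mx1 : conj_mx 1%:M = 1%:M.
Proof. by rewrite /conj_mx mulmx1 mulmxV. Qed.

Lemma conj_mx_surj x : exists y, x = conj_mx y.
Proof.
exists (invmx g *m x *m g).
by rewrite /conj_mx !mulmxA mulmxV // mul1mx mulmxK.
Qed.

Lemma dim_lker_anticomm_conj y :
  \dim (lker (linfun (anticomm (conj_mx y)))) = \dim (lker (linfun (anticomm y))).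
Proof.
rewrite -(@limg_dim_eq _ _ _ (linfun conj_mx) (lker (linfun (anticomm y)))); last first.
  apply/eqP; rewrite -subv0; apply/subvP => x; rewrite memv_cap.
  case/andP => _; rewrite memv_ker lfunE /= => /eqP x0; suff -> : x = 0 by rewrite mem0v.
  by apply: conj_mx_inj; rewrite x0 linear0.
congr (\dim _); apply/vspaceP => x; have [z ->] := conj_mx_surj x.
rewrite memv_ker lfunE /= conj_mx_anticomm.
apply/eqP/memv_imgP => [z0|[t + ]].
  exists z; rewrite ?lfunE // memv_ker lfunE; apply/eqP/conj_mx_inj.
  by rewrite [LHS]z0 linear0.
rewrite memv_ker !lfunE /= => /eqP t0 zt.
by rewrite (conj_mx_inj zt) t0 linear0.
Qed.

End Conjugation.

(** * Odd part of the queer algebra *)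

(** It suffices to test against off-diagonal elementary matrices and differences of diagonal
    ones. *)
Lemma trace_dual_scalar (F : fieldType) (n : nat) (A : 'M[F]_n) : (0 < n)%N ->
  (forall c, \tr c = 0 -> \tr (c *m A) = 0) -> exists a, A = a%:M.
Proof.
move=> n_gt0 orth; pose i0 := Ordinal n_gt0.
have trE i j : \tr (delta_mx i j *m A) = A j i.
  by rewrite mxtrace_mulC mxtrace_mul_delta.
have trd i j : \tr (delta_mx i j : 'M[F]_n) = (i == j)%:R.
  by rewrite -[delta_mx i j]mul1mx mxtrace_mul_delta mxE eq_sym.
exists (A i0 i0); apply/matrixP => i j; rewrite [RHS]mxE.
have [<-|ij] := eqVneq i j; last by rewrite -trE orth // trd eq_sym (negbTE ij).
apply/eqP; rewrite mulr1n -subr_eq0 -(trE i i) -(trE i0 i0) -raddfB -mulmxBl.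
by apply/eqP/orth; rewrite raddfB /= !trd !eqxx subrr.
Qed.

Lemma trace_dual_eq0 (F : fieldType) (n : nat) (A : 'M[F]_n) :
  (forall c, \tr (c *m A) = 0) -> A = 0.
Proof.
move=> orth; apply/matrixP => i j; rewrite [RHS]mxE -(orth (delta_mx j i)).
by rewrite mxtrace_mulC mxtrace_mul_delta.
Qed.

Lemma mxtrace_anticomm (F : fieldType) (n : nat) (y a c : 'M[F]_n) :
  \tr (c *m anticomm y a) = \tr (anticomm y c *m a).
Proof.
by rewrite /anticomm mulmxDr mulmxDl !raddfD /= !mulmxA (mxtrace_mulC (c *m a)) mulmxA addrC.
Qed.

Definition odd_mx (F : fieldType) (n : nat) (b : 'M[F]_n) : 'M[F]_(n + n) :=
  block_mx 0 b b 0.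

Lemma odd_mx_is_linear (F : fieldType) (n : nat) : linear (@odd_mx F n).
Proof.
by move=> c a b; rewrite /odd_mx scale_block_mx add_block_mx !scaler0 !addr0.
Qed.
HB.instance Definition _ (F : fieldType) (n : nat) :=
  GRing.isLinear.Build F 'M[F]_n 'M[F]_(n + n) _ (@odd_mx F n)
    (@odd_mx_is_linear F n).

Lemma odd_mx_inj (F : fieldType) (n : nat) : injective (@odd_mx F n).
Proof. by move=> a b /eq_block_mx[]. Qed.

Lemma dim_odd_mx (F : fieldType) (n : nat) (W : {vspace 'M[F]_n}) :
  \dim (linfun (@odd_mx F n) @: W) = \dim W.
Proof.
apply/limg_dim_eq/eqP; rewrite -subv0; apply/subvP => x; rewrite memv_cap.
case/andP => _; rewrite memv_ker lfunE /= => /eqP x0; suff -> : x = 0 by rewrite mem0v.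
by apply: odd_mx_inj; rewrite x0 linear0.
Qed.

Lemma sbracket_odd_mx (F : fieldType) (n : nat) (a b : 'M[F]_n) :
  ulsubmx (sbracket (odd_mx a) (odd_mx b)) = a *m b + b *m a.
Proof.
rewrite -[odd_mx a]/(qmx (0, a)) -[odd_mx b]/(qmx (0, b)) sbracket_qmx.
by rewrite /qmx block_mxKul /= !mulmx0 subrr add0r.
Qed.

Definition traceless (F : fieldType) (n : nat) : {vspace 'M[F]_n} :=
  lker (linfun (@mxtrace F n : 'M[F]_n -> F^o)).

Lemma memv_traceless (F : fieldType) (n : nat) (x : 'M[F]_n) :
  (x \in traceless F n) = (\tr x == 0).
Proof. by rewrite memv_ker lfunE. Qed.

Lemma oddsub_qalg (F : fieldType) (n : nat) :
  oddsub (qalg F n) = (linfun (@odd_mx F n) @: fullv)%VS.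
Proof.
apply/vspaceP => x; apply/oddsubP/memv_imgP => [[b ->]|[b _ ->]].
  by exists b; rewrite ?memvf // lfunE.
by exists b; rewrite lfunE.
Qed.

Lemma oddsub_derived_qalg (F : fieldType) (n : nat) : (0 < n)%N -> 2%:R != 0 :> F ->
  oddsub (derived (qalg F n)) = (linfun (@odd_mx F n) @: traceless F n)%VS.
Proof.
move=> n_gt0 char2; apply/vspaceP => x; rewrite memv_cap memv_ker lfunE /=.
apply/andP/memv_imgP => [[/(derived_qalgP _ n_gt0 char2)[a [b [trb ->]]]]|[b trb ->]].
  rewrite /evenpart block_mxKul block_mxKdr => /eqP.
  rewrite -[RHS](@block_mx0 _ n n n n) => /eq_block_mx[-> _ _ _].
  by exists b; rewrite ?lfunE // memv_traceless trb.
rewrite lfunE; split.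
  apply/(derived_qalgP _ n_gt0 char2); exists 0, b; split=> //.
  by apply/eqP; rewrite -memv_traceless.
by rewrite /= /evenpart /odd_mx block_mxKul block_mxKdr block_mx0.
Qed.

(** The trace is a nonzero functional on [W], so its kernel there is a hyperplane. *)
Lemma dim_traceless_cap (F : fieldType) (n : nat) (W : {vspace 'M[F]_n}) z :
  z \in W -> \tr z != 0 -> (\dim (W :&: traceless F n)).+1 = \dim W.
Proof.
move=> zW trz; rewrite -(limg_ker_dim (linfun (@mxtrace F n : 'M[F]_n -> F^o)) W).
rewrite -addn1; congr (_ + _)%N; apply/esym/eqP; rewrite eqn_leq.
apply/andP; split.
  by rewrite -[leqRHS](dimvf [the vectType F of F^o]) dimvS ?subvf.
rewrite lt0n dimv_eq0; apply: contraNneq trz => h.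
suff : (\tr z : F^o) \in 0%VS by rewrite memv0.
by rewrite -h; apply/memv_imgP; exists z; rewrite ?lfunE.
Qed.

(** * Kernel and radical at a point of the orbit *)

Section OrbitPoint.
Variables (F : fieldType) (n : nat) (mu : seq nat) (y : 'M[F]_n).
Hypotheses (sum_mu : sumn mu = n) (Oy : nilp_orbit mu y).

Lemma mxtrace_orbit : \tr y = 0.
Proof.
have [g g_unit ->] := Oy; rewrite -/(conj_mx g _) mxtrace_conj // /mxtrace.
by rewrite big1 // => i _; rewrite mxE (ltn_eqF (ltnSn _)).
Qed.

Lemma dim_kernel_orbit :
  \dim (lker (linfun (anticomm y))) = (\sum_(1 <= i < n.+1) dual_part mu i ^ 2)%N.
Proof.
have [g g_unit ->] := Oy.
by rewrite -/(conj_mx g _) dim_lker_anticomm_conj // kernel_dim_dual.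
Qed.

Lemma orbit_anticomm_one : ~~ has odd mu ->
  exists2 x, anticomm y x = 1%:M & \tr x = 0.
Proof.
have [g g_unit ->] := Oy => /(jordan_anticomm_one F sum_mu)[x x1 trx].
exists (conj_mx g x); last by rewrite mxtrace_conj.
by rewrite -/(conj_mx g _) conj_mx_anticomm // x1 conj_mx1.
Qed.

Lemma orbit_anticomm_trace : has odd mu ->
  exists2 z, anticomm y z = 0 & \tr z != 0.
Proof.
have [g g_unit ->] := Oy => /(jordan_anticomm_trace F sum_mu)[z z0 trz].
exists (conj_mx g z); last by rewrite mxtrace_conj.
by rewrite -/(conj_mx g _) conj_mx_anticomm // z0 linear0.
Qed.

(* The radical of tr((c x + x c) y) on sl(n): under the trace form the
   orthogonal of sl(n) consists of the scalar matrices. *)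
Lemma traceless_radical : (0 < n)%N -> exists K : {vspace 'M[F]_n},
  (forall x, x \in K <-> x \in traceless F n /\
     forall c, c \in traceless F n -> \tr (c *m anticomm y x) = 0) /\
  (\dim K).+1 = (\dim (lker (linfun (anticomm y))) + (~~ has odd mu).*2)%N.
Proof.
move=> n_gt0; have orthP x :
    (forall c, c \in traceless F n -> \tr (c *m anticomm y x) = 0) <->
    exists a, anticomm y x = a%:M.
  split=> [orth|[a ->] c].
    by apply: trace_dual_scalar => // c /eqP; rewrite -memv_traceless; apply: orth.
  by rewrite memv_traceless mul_mx_scalar mxtraceZ => /eqP ->; rewrite mulr0.
have [mu_odd|mu_even] /= := boolP (has odd mu).
  have [z z0 trz] := orbit_anticomm_trace mu_odd.
  exists (lker (linfun (anticomm y)) :&: traceless F n)%VS; split; last first.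
    have zK : z \in lker (linfun (anticomm y)) by rewrite memv_ker lfunE /= z0.
    by rewrite addn0 (dim_traceless_cap zK trz).
  move=> x; rewrite memv_cap memv_ker lfunE /=.
  split=> [/andP[/eqP xK trx]|[trx /orthP[a xa]]].
    by split=> // c _; rewrite xK mulmx0 mxtrace0.
  (* Pairing [anticomm y x = a%:M] with [z] in the kernel gives [a * \tr z = 0], hence [a = 0]. *)
  rewrite trx andbT xa; have := mxtrace_anticomm y x z.
  rewrite z0 mul0mx mxtrace0 xa mul_mx_scalar mxtraceZ => /eqP.
  by rewrite mulf_eq0 (negbTE trz) orbF => /eqP ->; rewrite raddf0.
have [x0 x01 trx0] := orbit_anticomm_one mu_even.
exists (lker (linfun (anticomm y)) + <[x0]>)%VS; split; last first.
  rewrite dimv_disjoint_sum.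
    rewrite dim_vline; case: eqVneq x01 => [->|_ _]; last by rewrite addn1 addn2.
    rewrite linear0 => /matrixP /(_ (Ordinal n_gt0) (Ordinal n_gt0)) /eqP.
    by rewrite !mxE eqxx eq_sym oner_eq0.
  apply/eqP; rewrite -subv0; apply/subvP => x; rewrite memv_cap => /andP[+ /vlineP[a xa]].
  rewrite memv_ker lfunE /= xa linearZ /= x01 scalemx1 => /eqP a0.
  have /matrixP /(_ (Ordinal n_gt0) (Ordinal n_gt0)) := a0.
  by rewrite !mxE eqxx mulr1n => ->; rewrite scale0r mem0v.
move=> x; split=> [/memv_addP[z + [_ /vlineP[a ->] ->]]|[trx /orthP[a xa]]].
  rewrite memv_ker lfunE /= => /eqP z0; split; last first.
    by apply/orthP; exists a; rewrite linearD linearZ /= z0 x01 add0r scalemx1.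
  (* By self-adjointness, [\tr z = \tr (z *m anticomm y x0) = \tr (anticomm y z *m x0) = 0]. *)
  rewrite memv_traceless raddfD /= mxtraceZ trx0 mulr0 addr0.
  by rewrite -[z]mulmx1 -x01 mxtrace_anticomm z0 mul0mx mxtrace0.
rewrite -[x](subrK (a *: x0)); apply: memv_add; last by rewrite memvZ ?memv_line.
by rewrite memv_ker lfunE /= linearB linearZ /= xa x01 scalemx1 subrr.
Qed.

End OrbitPoint.

(** * From radicals on the orbit to ranks over the residue field *)

Section BracketRank.
Variables (F : closedFieldType) (n : nat) (mu : seq nat).
Variables (kappa : {symmetric 'M[F]_n}) (q : prime_idealr {mpoly F[n * n]}).
Hypothesis char2 : 2%:R != 0 :> F.
Hypothesis n_gt1 : (1 < n)%N.
Hypothesis kappa_nondeg : nondegenerate kappa.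
Hypothesis kappa_inv : invariant_form kappa.
Hypothesis zero_q :
  forall x, zero_set kappa q x <-> zariski_closure (nilp_orbit mu) x.

Local Notation oddF := (linfun (@odd_mx F n)).

Lemma form_bracket_suml (y : 'M[F]_n) (x : 'M[F]_(n + n)) (d : nat)
    (c : 'I_d -> F) (X : 'I_d -> 'M[F]_(n + n)) :
  kappa (ulsubmx (sbracket (\sum_i c i *: X i) x)) y =
  \sum_i c i * kappa (ulsubmx (sbracket (X i) x)) y.
Proof.
pose f z : 'M[F]_n := ulsubmx (sbracket z x).
have f_lin : linear f.
  by move=> a u v; rewrite /f sbracket_linearl; apply/matrixP => i k; rewrite !mxE.
pose fL : {linear _ -> _} := HB.pack f (GRing.isLinear.Build F _ _ _ f f_lin).
rewrite -/(f _) -[f _]/(fL _) linear_sum linear_sumlz.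
by apply: eq_bigr => i _; rewrite linearZ linearZl_LR.
Qed.

Lemma form_bracket_sumr (y : 'M[F]_n) (x : 'M[F]_(n + n)) (d : nat)
    (c : 'I_d -> F) (X : 'I_d -> 'M[F]_(n + n)) :
  kappa (ulsubmx (sbracket x (\sum_i c i *: X i))) y =
  \sum_i c i * kappa (ulsubmx (sbracket x (X i))) y.
Proof.
pose f z : 'M[F]_n := ulsubmx (sbracket x z).
have f_lin : linear f.
  by move=> a u v; rewrite /f sbracket_linearr; apply/matrixP => i k; rewrite !mxE.
pose fL : {linear _ -> _} := HB.pack f (GRing.isLinear.Build F _ _ _ f f_lin).
rewrite -/(f _) -[f _]/(fL _) linear_sum linear_sumlz.
by apply: eq_bigr => i _; rewrite linearZ linearZl_LR.
Qed.

(** At each point of the orbit [gram_rank] turns the dimension of the radical into the rank of the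
    evaluated Gram matrix. This rank is constant on the orbit, so [generic_rank] carries it to the
    residue field. *)
Lemma bracket_rank_odd (W : {vspace 'M[F]_n}) (r : nat) :
  (forall y, nilp_orbit mu y -> exists K : {vspace 'M[F]_n},
     (forall x, x \in K <-> x \in W /\
        forall c, c \in W -> \tr (c *m anticomm y x) = 0) /\ \dim K = r) ->
  (bracket_rank q (oddF @: W) + r)%N = \dim W.
Proof.
move=> rad; pose b := vbasis (oddF @: W).
have rank_at y : nilp_orbit mu y ->
    (\rank (\matrix_(i < \dim (oddF @: W), j < \dim (oddF @: W))
       kappa (ulsubmx (sbracket b`_i b`_j)) y)%R + r)%N = \dim W.
  move=> Oy; have [K [KP <-]] := rad y Oy.
  have [al al0 kappaE] := invariant_form_trace char2 kappa_nondeg kappa_inv n_gt1.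
  have kappa_odd a c : kappa (ulsubmx (sbracket (odd_mx a) (odd_mx c))) y =
      al * \tr (c *m anticomm y a).
    rewrite sbracket_odd_mx kappaE ?(mxtrace_orbit Oy) // /anticomm; congr (_ * _).
    by rewrite mulmxDl mulmxDr !raddfD /= mxtrace_mulC !mulmxA mxtrace_mulC mulmxA addrC.
  rewrite -(dim_odd_mx K) -(dim_odd_mx W).
  pose f (j : 'I_(\dim (oddF @: W))) x := kappa (ulsubmx (sbracket x b`_j)) y.
  apply: (gram_rank (b := b) (f := f)); rewrite {}/f /=.
  - exact: basis_free (vbasisP _).
  - by move=> j c; apply: form_bracket_suml.
  - move=> x; rewrite (span_basis (vbasisP _)).
    split=> [/memv_imgP[a /KP[aW orth] ->]|[/memv_imgP[a aW ->] orth]].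
      split=> [|j]; first exact: memv_img.
      have /memv_imgP[c cW ->] : b`_j \in (oddF @: W)%VS.
        by apply/vbasis_mem/mem_nth; rewrite size_tuple.
      by rewrite !lfunE /= kappa_odd orth ?mulr0.
    apply/memv_img/KP; split=> // c cW.
    apply: (mulfI al0); rewrite mulr0 -kappa_odd.
    have /coord_vbasis : oddF c \in (oddF @: W)%VS by apply: memv_img.
    rewrite -/b lfunE /= => ->; rewrite form_bracket_sumr big1 // => j _.
    by move: (orth j); rewrite lfunE /= => ->; rewrite mulr0.
(* This bound, read off at the Jordan matrix, makes the natural subtraction [\dim W - r] exact. *)
have r_le : (r <= \dim W)%N by rewrite -(rank_at _ (nilp_orbit_jordan F n mu)) leq_addl.
have -> : bracket_rank q (oddF @: W) = (\dim W - r)%N; last by rewrite subnK.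
pose A : 'M[{mpoly F[n * n]}]_(\dim (oddF @: W)) :=
  \matrix_(i, j) sym_lin (ulsubmx (sbracket b`_i b`_j)).
rewrite /bracket_rank (_ : bracket_gram q _ = map_mx (to_residue q) A).
  apply: (generic_rank kappa_nondeg zero_q) => y Oy.
  rewrite -(rank_at y Oy) addnK; congr (\rank _); apply/matrixP => i j.
  by rewrite !mxE sym_eval_lin.
by apply/matrixP => i j; rewrite !mxE !(tnth_nth 0).
Qed.

(** The trace form is nondegenerate on gl(n), so the radical is the kernel of [anticomm y]. *)
Lemma bracket_rank_queer : sumn mu = n ->
  (bracket_rank q (oddsub (qalg F n))
     + \sum_(1 <= i < n.+1) dual_part mu i ^ 2)%N = (n * n)%N.
Proof.
move=> sum_mu; have -> : (n * n)%N = \dim {:'M[F]_n} by rewrite dimvf.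
rewrite oddsub_qalg; apply: bracket_rank_odd => y Oy.
exists (lker (linfun (anticomm y))); split; last exact: dim_kernel_orbit.
move=> x; rewrite memv_ker lfunE /=; split=> [/eqP x0|[_ orth]].
  by split=> [|c _]; rewrite ?memvf // x0 mulmx0 mxtrace0.
by apply/eqP/trace_dual_eq0 => c; apply: orth; rewrite memvf.
Qed.

(** With [e] for [eps_even mu], the space has dimension [n * n - 1] and the radical [N + 2 * e - 1],
    so the rank is [n * n - N - 2 * e]. *)
Lemma bracket_rank_derived : sumn mu = n ->
  (bracket_rank q (oddsub (derived (qalg F n))) + 2 * eps_even mu)%N =
  bracket_rank q (oddsub (qalg F n)).
Proof.
move=> sum_mu; have n_gt0 := ltnW n_gt1; have full := bracket_rank_queer sum_mu.
have -> : eps_even mu = ~~ has odd mu by rewrite /eps_even -all_predC.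
set N := (\sum_(1 <= i < n.+1) _)%N in full.
have rad y : nilp_orbit mu y -> exists K : {vspace 'M[F]_n},
    (forall x, x \in K <-> x \in traceless F n /\
        forall c, c \in traceless F n -> \tr (c *m anticomm y x) = 0) /\
    \dim K = (N + (~~ has odd mu).*2).-1.
  move=> Oy; have [K [KP dimK]] := traceless_radical sum_mu Oy n_gt0.
  by exists K; split=> //; rewrite /N -(dim_kernel_orbit sum_mu Oy) -dimK.
(* Positivity ensures that the predecessor in [rad] really subtracts one. *)
have N_gt0 : (0 < N + (~~ has odd mu).*2)%N.
  have Oy := nilp_orbit_jordan F n mu.
  have [K [_ dimK]] := traceless_radical sum_mu Oy n_gt0.
  by rewrite /N -(dim_kernel_orbit sum_mu Oy) -dimK.
have dim_sl : (\dim (traceless F n)).+1 = (n * n)%N.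
  pose i0 := Ordinal n_gt0; pose z : 'M[F]_n := delta_mx i0 i0.
  have trz : \tr z != 0.
    by rewrite -[z]mul1mx mxtrace_mul_delta mxE eqxx oner_eq0.
  by have := dim_traceless_cap (memvf z) trz; rewrite capfv dimvf.
have := bracket_rank_odd rad; rewrite -(oddsub_derived_qalg n_gt0 char2) => h.
apply/eqP; rewrite -(eqn_add2r N) full -dim_sl -h -addnS prednK //.
by rewrite mul2n addnAC -addnA.
Qed.

End BracketRank.

Theorem theorem3p7 (R : realType) (n : nat) (mu : seq nat)
    (kappa : {symmetric 'M[R[i]]_n})
    (q : prime_idealr {mpoly R[i][n * n]}) :
  (3 <= n)%N ->
  is_partition n mu ->
  nondegenerate kappa ->
  invariant_form kappa ->
  (forall x : 'M[R[i]]_n,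
      zero_set kappa q x <-> zariski_closure (nilp_orbit mu) x) ->
  let g := qalg R[i] n in
  let g' := derived g in
  let k := bracket_rank q (oddsub g) in
  let k' := bracket_rank q (oddsub g') in
  k%:Z = (\dim (oddsub g))%:Z
         - (\sum_(1 <= i < n.+1) dual_part mu i ^ 2)%N%:Z
  /\ k'%:Z = k%:Z - 2 * (eps_even mu)%:Z.
Proof.
move=> n_ge3 /and3P[_ _ /eqP sum_mu] kappa_nondeg kappa_inv zero_q g g' k k'.
have n_gt1 : (1 < n)%N := ltnW n_ge3.
have char2 : 2%:R != 0 :> R[i] by rewrite Num.Theory.pnatr_eq0.
have kE := bracket_rank_queer char2 n_gt1 kappa_nondeg kappa_inv zero_q sum_mu.
have k'E := bracket_rank_derived char2 n_gt1 kappa_nondeg kappa_inv zero_q sum_mu.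
have dim_g : \dim (oddsub g) = (n * n)%N by rewrite oddsub_qalg dim_odd_mx dimvf.
split; first by rewrite dim_g -kE PoszD addrK.
by rewrite /k -k'E PoszD PoszM addrK.
Qed.
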